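(* Let $X$ be a projective toric variety. For any sufficiently ample line bundle $L_1$ on $X$, the multiplication map $$\Phi_{L_1,L_2}: H^0(X,L_1)\otimes H^0(X,L_2)\to H^0(X,L_1\otimes L_2)$$ is surjective for every nef line bundle $L_2$ on $X$. That is, there is a constant $N$ depending only on $X$ such that for every ample line bundle $L_1$ on $X$ with $\mathbb E(L_1)\ge N$ and every nef line bundle $L_2$ on $X$, the map $\Phi_{L_1,L_2}$ is surjective.
   Context: Toric varieties are normal and over a fixed algebraically closed field; $M$ is the character lattice of the torus. For a nef line bundle $L$ on $X$, $P_L\subset M_{\mathbb R}$ is the associated lattice polytope, and $\mathbb E(L)$ denotes the minimum of the lattice lengths of the edges of $P_L$. For ample $L$, the edges of $P_L$ correspond to the torus-invariant curves $C$ of $X$, and the lattice length of the edge corresponding to $C$ is the intersection number $L.C$. *)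

(* Defs.v *)
From HB Require Import structures.
From mathcomp Require Import all_boot all_order all_algebra.
From mathcomp Require Import mpoly.
From mathcomp Require Import reals.

Set Implicit Arguments.
Unset Strict Implicit.
Unset Printing Implicit Defensive.

Import Order.TTheory GRing.Theory Num.Theory.
Local Open Scope ring_scope.

(** * Fans *)

(* M = N = Z^n and M_R = N_R = R^n as row vectors, paired by the dot product. *)
Definition dot (R : realType) (n : nat) (u v : 'rV[R]_n) : R :=
  \sum_(i < n) u 0 i * v 0 i.

Definition ofZ (R : realType) (n : nat) (m : 'rV[int]_n) : 'rV[R]_n :=
  map_mx (fun z : int => z%:~R) m.

Definition conic_hull (R : realType) (n : nat) (G : seq 'rV[int]_n)
    (x : 'rV[R]_n) : Prop :=
  exists2 c : 'rV[int]_n -> R, (forall v, 0 <= c v) &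
    x = \sum_(v <- G) c v *: ofZ R v.

Definition strongly_convex (R : realType) (n : nat) (C : 'rV[R]_n -> Prop) :=
  forall x, C x -> C (- x) -> x = 0.

(* [F] is a face of the cone [C]. *)
Definition cone_face (R : realType) (n : nat) (F C : 'rV[R]_n -> Prop) : Prop :=
  exists2 u : 'rV[R]_n, (forall x, C x -> 0 <= dot u x) &
    forall x, F x <-> C x /\ dot u x = 0.

Definition cap (R : realType) (n : nat) (C D : 'rV[R]_n -> Prop)
    (x : 'rV[R]_n) : Prop := C x /\ D x.

(* A fan in N_R: the [i]-th cone is generated by the finite list of lattice
   vectors [fan_gens i]. *)
Record fan (R : realType) (n : nat) : Type := Fan {
  fan_size : nat;
  fan_gens : 'I_fan_size -> seq 'rV[int]_n;
  fan_pointed : forall i, strongly_convex (conic_hull (R := R) (fan_gens i));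
  fan_faces : forall i (F : 'rV[R]_n -> Prop),
    cone_face F (conic_hull (fan_gens i)) ->
    exists j, forall x, conic_hull (fan_gens j) x <-> F x;
  fan_caps : forall i j,
    cone_face (cap (conic_hull (R := R) (fan_gens i)) (conic_hull (fan_gens j)))
              (conic_hull (fan_gens i)) }.

Definition fan_cone (R : realType) (n : nat) (X : fan R n) (i : 'I_(fan_size X)) :
  'rV[R]_n -> Prop := conic_hull (fan_gens i).

Definition complete_fan (R : realType) (n : nat) (X : fan R n) : Prop :=
  forall x, exists i, @fan_cone R n X i x.

(** * The toric variety of a fan

   All the rings k[sigma^\vee \cap M], hence all the affine charts of the toric
   variety, live in the function field k(M) of the torus. *)

Definition funK (k : closedFieldType) (n : nat) : fieldType :=
  {fraction {mpoly k[n]}}.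

Definition constK (k : closedFieldType) (n : nat) (c : k) : funK k n :=
  tofrac (c%:MP : {mpoly k[n]}).

(* The character of the torus with exponent [m] in M. *)
Definition chi (k : closedFieldType) (n : nat) (m : 'rV[int]_n) : funK k n :=
  \prod_(i < n) (tofrac ('X_i : {mpoly k[n]}) : funK k n) ^ (m 0 i).

(* The subring k[C^\vee \cap M] of k(M): the coordinate ring of U_C. *)
Definition reg (R : realType) (k : closedFieldType) (n : nat)
    (C : 'rV[R]_n -> Prop) (f : funK k n) : Prop :=
  exists2 r : seq (k * 'rV[int]_n),
    (forall t, t \in r -> forall x, C x -> 0 <= dot (ofZ R t.2) x) &
    f = \sum_(t <- r) constK n t.1 * chi k t.2.

Definition chart (R : realType) (k : closedFieldType) (n : nat) (X : fan R n)
    (i : 'I_(fan_size X)) : funK k n -> Prop := reg (fan_cone i).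

(* U_sigma \cap U_tau = U_(sigma \cap tau) *)
Definition overlap (R : realType) (k : closedFieldType) (n : nat) (X : fan R n)
    (i j : 'I_(fan_size X)) : funK k n -> Prop :=
  reg (cap (fan_cone i) (fan_cone j)).

(* [x] restricts to a k-algebra morphism A -> B, i.e. a B-valued point of
   Spec A; the values of [x] outside [A] are irrelevant. *)
Definition is_point (k : closedFieldType) (n : nat) (A : funK k n -> Prop)
    (B : fieldType) (iota : {rmorphism k -> B}) (x : funK k n -> B) : Prop :=
  (forall c, x (constK n c) = iota c) /\
  (forall f g, A f -> A g -> x (f + g) = x f + x g /\ x (f * g) = x f * x g).

Definition is_kpoint (R : realType) (k : closedFieldType) (n : nat) (X : fan R n)
    (i : 'I_(fan_size X)) (x : funK k n -> k) : Prop :=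
  is_point (chart i) idfun x.

(* The gluing of the charts along their overlaps. *)
Definition same_kpoint (R : realType) (k : closedFieldType) (n : nat)
    (X : fan R n) (i : 'I_(fan_size X)) (x : funK k n -> k)
    (j : 'I_(fan_size X)) (y : funK k n -> k) : Prop :=
  exists z : funK k n -> k, [/\ is_point (overlap i j) idfun z,
    (forall f, chart i f -> z f = x f) & (forall f, chart j f -> z f = y f)].

(* The local ring of the variety at the point [x] of the [i]-th chart. *)
Definition local_ring (R : realType) (k : closedFieldType) (n : nat)
    (X : fan R n) (i : 'I_(fan_size X)) (x : funK k n -> k) (h : funK k n) :=
  exists f g, [/\ chart i f, chart i g, x g != 0 & h = f / g].

(** * Line bundles

   As the Picard group of an affine toric variety is trivial, a line bundle is
   given by local equations [L i] in k(M)^* on the charts U_i, two of them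
   differing by a unit on U_i \cap U_j.  Its sections over an open set U are
   the g in k(M) such that g * L i is regular on U \cap U_i for all i, and
   (L i)^-1 is a generator on U_i. *)

Definition local_equations (R : realType) (k : closedFieldType) (n : nat)
  (X : fan R n) : Type := 'I_(fan_size X) -> funK k n.

Definition line_bundle (R : realType) (k : closedFieldType) (n : nat)
    (X : fan R n) (L : local_equations k X) : Prop :=
  (forall i, L i != 0) /\ (forall i j, overlap i j (L i / L j)).

Definition tensor (R : realType) (k : closedFieldType) (n : nat) (X : fan R n)
  (L1 L2 : local_equations k X) : local_equations k X := fun i => L1 i * L2 i.

Definition tensor_pow (R : realType) (k : closedFieldType) (n : nat)
  (X : fan R n) (L : local_equations k X) (d : nat) : local_equations k X :=
  fun i => L i ^+ d.

Definition isom (R : realType) (k : closedFieldType) (n : nat) (X : fan R n)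
    (L1 L2 : local_equations k X) : Prop :=
  exists2 g : funK k n, g != 0 &
    forall i, chart i (L1 i / (g * L2 i)) /\ chart i (g * L2 i / L1 i).

Definition H0 (R : realType) (k : closedFieldType) (n : nat) (X : fan R n)
    (L : local_equations k X) (g : funK k n) : Prop :=
  forall i, chart i (g * L i).

(* Surjectivity of H^0(L1) (x) H^0(L2) -> H^0(L1 (x) L2). *)
Definition mult_surjective (R : realType) (k : closedFieldType) (n : nat)
    (X : fan R n) (L1 L2 : local_equations k X) : Prop :=
  forall f, H0 (tensor L1 L2) f ->
    exists2 r : seq (funK k n * funK k n),
      (forall t, t \in r -> H0 L1 t.1 /\ H0 L2 t.2) &
      f = \sum_(t <- r) t.1 * t.2.

(** * Ampleness *)

(* Some global sections s_0, ..., s_r of L generate L and define a closed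
   immersion into P^r: a morphism which is injective on k-points and
   surjective on local rings (its image is closed, and it is a homeomorphism
   onto it, because the variety is complete).  The homogeneous coordinates of
   the image of the point [x] of the [i]-th chart are the x (s_l * L i). *)
Definition very_ample (R : realType) (k : closedFieldType) (n : nat)
    (X : fan R n) (L : local_equations k X) : Prop :=
  exists (r : nat) (s : 'I_r.+1 -> funK k n),
  [/\ forall l, H0 L (s l),
      forall i x, is_kpoint i x -> exists l, x (s l * L i) != 0,
      forall i x j y, is_kpoint i x -> is_kpoint j y ->
        (exists2 c : k, c != 0 &
           forall l, y (s l * L j) = c * x (s l * L i)) ->
        same_kpoint i x j y &
      forall i x l, is_kpoint i x -> x (s l * L i) != 0 ->
        forall h, local_ring i x h ->
        exists p q : {mpoly k[r.+1]},
          meval (fun a => x (s a * L i) / x (s l * L i)) q != 0 /\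
          h = mmap (@constK k n) (fun a => s a / s l) p
              / mmap (@constK k n) (fun a => s a / s l) q].

Definition ample (R : realType) (k : closedFieldType) (n : nat)
    (X : fan R n) (L : local_equations k X) : Prop :=
  exists2 d : nat, (0 < d)%N & very_ample (tensor_pow L d).

Definition projective (R : realType) (k : closedFieldType) (n : nat)
    (X : fan R n) : Prop :=
  complete_fan X /\
  exists2 L : local_equations k X, line_bundle L & very_ample L.

(** * Nefness *)

(* F/k is finitely generated of transcendence degree 1: F is a finite
   extension of k(t), with t transcendental over k. *)
Definition curve_function_field (k : closedFieldType) (F : fieldType)
    (iota : {rmorphism k -> F}) : Prop :=
  exists t : F, (forall p : {poly k}, p != 0 -> (map_poly iota p).[t] != 0) /\
  exists (d : nat) (b : 'I_d -> F), forall f : F,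
  exists (q : {poly k}) (p : 'I_d -> {poly k}), q != 0 /\
    (map_poly iota q).[t] * f = \sum_(a < d) (map_poly iota (p a)).[t] * b a.

(* Normalized discrete valuations of F/k, i.e. the closed points of the smooth
   projective curve with function field F; the value at 0 is set to 0. *)
Definition place (k : closedFieldType) (F : fieldType)
    (iota : {rmorphism k -> F}) (v : F -> int) : Prop :=
  [/\ v 0 = 0,
      forall x y, x != 0 -> y != 0 -> v (x * y) = v x + v y,
      forall x y, x != 0 -> y != 0 -> x + y != 0 ->
        Num.min (v x) (v y) <= v (x + y),
      forall c, c != 0 -> v (iota c) = 0 &
      exists2 x, x != 0 & v x = 1].

(* Let phi : C -> X be the morphism from the smooth projective curve of F whose
   restriction to the generic point is the point [x] of the [i]-th chart.  Then
   (L i)^-1 pulls back to a rational section of phi^* L, and [e] is its order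
   at the place [v]: phi maps [v] into some chart U_j, where phi^* L is
   generated by (L j)^-1. *)
Definition pullback_order (R : realType) (k : closedFieldType) (n : nat)
    (X : fan R n) (L : local_equations k X) (F : fieldType)
    (iota : {rmorphism k -> F}) (i : 'I_(fan_size X)) (x : funK k n -> F)
    (v : F -> int) (e : int) : Prop :=
  exists (j : 'I_(fan_size X)) (y : funK k n -> F),
  [/\ is_point (overlap i j) iota y,
      forall f, chart i f -> y f = x f,
      forall f, chart j f -> 0 <= v (y f) &
      e = v (y (L j / L i))].

(* deg phi^* L = d, computed with any finite list of distinct places that
   contains all those where the section above has nonzero order. *)
Definition curve_degree (R : realType) (k : closedFieldType) (n : nat)
    (X : fan R n) (L : local_equations k X) (F : fieldType)
    (iota : {rmorphism k -> F}) (i : 'I_(fan_size X)) (x : funK k n -> F)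
    (d : int) : Prop :=
  exists (r : nat) (v : 'I_r -> F -> int) (e : 'I_r -> int),
  [/\ forall a, place iota (v a) /\ pullback_order L iota i x (v a) (e a),
      forall a b, v a =1 v b -> a = b,
      forall w c, place iota w -> pullback_order L iota i x w c -> c != 0 ->
        exists a, v a =1 w &
      d = \sum_(a < r) e a].

Definition nef (R : realType) (k : closedFieldType) (n : nat)
    (X : fan R n) (L : local_equations k X) : Prop :=
  forall (F : fieldType) (iota : {rmorphism k -> F}),
    curve_function_field iota ->
  forall (i : 'I_(fan_size X)) (x : funK k n -> F),
    is_point (chart i) iota x ->
  forall d : int, curve_degree L iota i x d -> 0 <= d.

(** * The polytope of a line bundle *)

(* O(D) for the torus-invariant Cartier divisor D equal to div(chi^(- m_i)) on
   U_i. *)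
Definition toric_bundle (R : realType) (k : closedFieldType) (n : nat)
    (X : fan R n) (m : 'I_(fan_size X) -> 'rV[int]_n) : local_equations k X :=
  fun i => chi k (- m i).

(* The polytope P_D of this divisor. *)
Definition divisor_polytope (R : realType) (n : nat) (X : fan R n)
    (m : 'I_(fan_size X) -> 'rV[int]_n) (p : 'rV[R]_n) : Prop :=
  forall i u, fan_cone i u -> dot (ofZ R (m i)) u <= dot p u.

(* The segment [a, b], with a <> b in M, is a face of P. *)
Definition lattice_edge (R : realType) (n : nat) (P : 'rV[R]_n -> Prop)
    (a b : 'rV[int]_n) : Prop :=
  a != b /\
  exists (u : 'rV[R]_n) (c : R), (forall p, P p -> c <= dot u p) /\
    forall p, (P p /\ dot u p = c) <->
      exists2 t : R, 0 <= t <= 1 & p = (1 - t) *: ofZ R a + t *: ofZ R b.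

(* The l such that b - a = l * e with e primitive in M. *)
Definition lattice_length (n : nat) (a b : 'rV[int]_n) : nat :=
  \big[gcdn/0%N]_(i < n) absz (b 0 i - a 0 i)%R.

(* E(L) >= N.  The polytope P_L is P_D for any torus-invariant Cartier divisor
   D with O(D) isomorphic to L; it is defined up to translation by M.  When
   P_L has no edge (a point), the minimum E(L) is +oo. *)
Definition min_edge_length_ge (R : realType) (k : closedFieldType) (n : nat)
    (X : fan R n) (L : local_equations k X) (N : nat) : Prop :=
  forall m : 'I_(fan_size X) -> 'rV[int]_n, isom L (toric_bundle k m) ->
  forall a b, lattice_edge (divisor_polytope m) a b ->
  (N <= lattice_length a b)%N.

(* Main.v *)
Require Import Defs.
From mathcomp Require Import all_boot all_order all_algebra.
From mathcomp Require Import mpoly.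
From mathcomp Require Import reals.
From mathcomp Require Import boolp classical_sets generic_quotient.
From mathcomp Require Import ring lra zify.

Set Implicit Arguments.
Unset Strict Implicit.
Unset Printing Implicit Defensive.

Import Order.TTheory GRing.Theory Num.Theory.
Local Open Scope ring_scope.

(** Up to a rational function and constants, a line bundle on [X] is given by
    characters [m i], one for each cone, because the ratio of two local equations
    is a unit of the ring of Laurent polynomials, hence a monomial
    ([line_bundle_toric]).  Its sections are spanned by the lattice points of the
    polytope P(m) cut out by the inequalities [<p, v> >= <m i, v>] for [v] in the
    [i]-th cone ([H0_toric], [H0_monomial]).  So the theorem says that every
    lattice point of P(m + q) is a sum of lattice points of P(m) and P(q), where
    [m] and [q] belong to the two line bundles.

    Both are concave in the sense of [nef_tuple]: [m j - m i] is nonnegative on the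
    [i]-th cone for any two maximal cones.  Concavity is a local condition: it may
    be tested where a generic segment crosses a wall, that is, an intersection of
    two maximal cones that spans a hyperplane ([local_global]).  For the nef bundle
    the local condition is the nonnegativity of the degree on the closure of an
    orbit of a one-parameter subgroup in the orbit of the wall, a curve with
    function field k(t) and limits at the places 0 and infinity
    ([nef_orbit_curve]).  For the ample bundle, concavity follows from sections that
    do not vanish at the torus-fixed points, and injectivity on the orbit of a wall
    shows that the two vertices adjacent along it differ ([very_ample_nef_tuple],
    [very_ample_strict]); they are then the ends of an edge of the polytope
    ([wall_edge]).

    The nef tuples are the integral solutions of finitely many linear inequalities
    with integer coefficients, so by Dickson's lemma they are generated by finitely
    many of them, up to linear ones ([nef_generators]).  Splitting off one generator
    [f] after the other, it suffices to write a lattice point of P(m + f) as the sum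
    of a lattice point of P(m) and a vertex of P(f) ([minkowski_decomposition]).
    This is possible as soon as [m - s f] is nef, with [s] the number of cones: a
    point [x] of P(m + f) is a convex combination of the vertices [m i + f i], one of
    the coefficients is at least [1 / s], and for this [i] the point [x - f i]
    satisfies the inequalities of P(m) ([translates_cover]).  Finally [m - s f] is
    nef if the edges of P(m) are long compared with the generators, because across a
    wall [f l - f i] is a small multiple of the edge [m l - m i]
    ([long_edges_nef]).  There are finitely many generators and they depend only on
    the fan, and so does the bound on the length of the edges. *)

(** * Pairings, theorems of the alternative, Dickson's lemma *)

(** The pairing [dot], over any commutative ring: characters and one-parameter
    subgroups are paired over the integers. *)
Definition dotp (K : comNzRingType) (n : nat) (u v : 'rV[K]_n) : K :=
  \sum_(i < n) u 0 i * v 0 i.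

Lemma dotE (R : realType) n (u v : 'rV[R]_n) : dot u v = dotp u v.
Proof. by []. Qed.

Section Pairing.
Variables (K : comNzRingType) (n : nat).
Implicit Types (u v w : 'rV[K]_n) (a : K).

Lemma dotpC u v : dotp u v = dotp v u.
Proof. by apply: eq_bigr => i _; rewrite mulrC. Qed.

Lemma dotpDl u v w : dotp (u + v) w = dotp u w + dotp v w.
Proof. by rewrite -big_split; apply: eq_bigr => i _; rewrite mxE mulrDl. Qed.

Lemma dotpZl a u v : dotp (a *: u) v = a * dotp u v.
Proof. by rewrite mulr_sumr; apply: eq_bigr => i _; rewrite mxE mulrA. Qed.

Lemma dotpDr u v w : dotp u (v + w) = dotp u v + dotp u w.
Proof. by rewrite dotpC dotpDl !(dotpC u). Qed.

Lemma dotpZr a u v : dotp u (a *: v) = a * dotp u v.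
Proof. by rewrite dotpC dotpZl dotpC. Qed.

Lemma dotp0l v : dotp 0 v = 0.
Proof. by rewrite -(scale0r 0) dotpZl mul0r. Qed.

Lemma dotp0r v : dotp v 0 = 0.
Proof. by rewrite dotpC dotp0l. Qed.

Lemma dotpNl u v : dotp (- u) v = - dotp u v.
Proof. by rewrite -scaleN1r dotpZl mulN1r. Qed.

Lemma dotpNr u v : dotp u (- v) = - dotp u v.
Proof. by rewrite dotpC dotpNl dotpC. Qed.

Lemma dotpBl u v w : dotp (u - v) w = dotp u w - dotp v w.
Proof. by rewrite dotpDl dotpNl. Qed.

Lemma dotpBr u v w : dotp u (v - w) = dotp u v - dotp u w.
Proof. by rewrite dotpDr dotpNr. Qed.

Lemma dotp_sumr I (r : seq I) (P : pred I) (F : I -> 'rV[K]_n) u :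
  dotp u (\sum_(i <- r | P i) F i) = \sum_(i <- r | P i) dotp u (F i).
Proof.
by apply: (big_morph (dotp u)) => [v w|]; [rewrite dotpDr | rewrite dotp0r].
Qed.

Lemma dotp_suml I (r : seq I) (P : pred I) (F : I -> 'rV[K]_n) u :
  dotp (\sum_(i <- r | P i) F i) u = \sum_(i <- r | P i) dotp (F i) u.
Proof. by rewrite dotpC dotp_sumr; apply: eq_bigr => i _; rewrite dotpC. Qed.

Lemma dotp_delta u i : dotp u (delta_mx 0 i) = u 0 i.
Proof.
rewrite /dotp (bigD1 i) //= mxE !eqxx mulr1 big1 ?addr0 // => j /negPf ji.
by rewrite mxE ji andbF mulr0.
Qed.

End Pairing.

Definition dotpE := (dotpDl, dotpDr, dotpZl, dotpZr, dotpNl, dotpNr,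
  dotp0l, dotp0r).

Lemma dotp_row_mx (K : comNzRingType) m n (u v : 'rV[K]_m) (w z : 'rV[K]_n) :
  dotp (row_mx u w) (row_mx v z) = dotp u v + dotp w z.
Proof.
rewrite /dotp big_split_ord /=; congr (_ + _); apply: eq_bigr => i _.
  by rewrite !row_mxEl.
by rewrite !row_mxEr.
Qed.

Lemma dotp_ge0_eq0 (K : realDomainType) n (x : 'rV[K]_n) :
  (forall p, 0 <= dotp p x) -> x = 0.
Proof.
move=> h; apply/rowP => i; rewrite mxE; apply/eqP; rewrite eq_le.
have := h (delta_mx 0 i); have := h (- delta_mx 0 i).
by rewrite dotpNl dotpC dotp_delta oppr_ge0 => -> ->.
Qed.

(** Elimination of one generator at a time.  If [p] is nonnegative on [G] and
    negative on [x] but also on the next generator [g], every vector [y] is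
    replaced by the combination of [y] and [g] on which [p] vanishes.  Nothing
    is divided, so the lemma also holds over the integers, where it provides
    lattice functionals; and only an arbitrary cone [C] containing [G] is
    mentioned, so that no coefficients have to be carried along. *)
Lemma farkas (K : realDomainType) n (C : 'rV[K]_n -> Prop) (C0 : C 0)
    (CD : forall y z, C y -> C z -> C (y + z))
    (CZ : forall a y, 0 <= a -> C y -> C (a *: y)) (G : seq 'rV[K]_n) x :
  (forall g, g \in G -> C g) ->
  (exists p, (forall g, g \in G -> 0 <= dotp p g) /\ dotp p x < 0) \/
  (exists2 a, 0 < a & C (a *: x)).
Proof.
elim: {G}(size G) {-2}G (erefl (size G)) x => [|m IH] [|g G] //=.
  move=> _ x _; have [[p px]|h] := pselect (exists p, dotp p x < 0).
    by left; exists p.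
  right; exists 1; rewrite ?ltr01 // scale1r (dotp_ge0_eq0 (x := x)) // => p.
  by rewrite leNgt; apply/negP => px; apply: h; exists p.
move=> [sG] x GC.
have GC' h : h \in G -> C h by move=> hG; apply: GC; rewrite inE hG orbT.
have gC : C g by apply: GC; rewrite inE eqxx.
have [[p [pG px]]|] := IH G sG x GC'; last by right.
have [pg|pg] := leP 0 (dotp p g).
  by left; exists p; split=> // h; rewrite inE => /orP[/eqP->|/pG].
pose al := - dotp p g; have al0 : 0 < al by rewrite oppr_gt0.
pose red y := al *: y + dotp p y *: g.
have redC h : h \in map red G -> C h.
  case/mapP => h' hG ->; apply: CD; first by apply: CZ; [exact: ltW|exact: GC'].
  by apply: CZ => //; exact: pG.
have qsplit q y : dotp (al *: q + dotp q g *: p) y = dotp q (red y).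
  by rewrite /red !dotpE; ring.
have smap : size (map red G) = m by rewrite size_map.
have [[q [qG qx]]|[a a0 Ca]] := IH _ smap (red x) redC.
- left; exists (al *: q + dotp q g *: p); split=> [h|]; last by rewrite qsplit.
  rewrite inE => /orP[/eqP->|hG]; last by rewrite qsplit; exact/qG/map_f.
  rewrite /al !dotpE (_ : _ + _ = 0) //; ring.
- right; exists (a * al); first exact: mulr_gt0.
  have -> : (a * al) *: x = a *: red x + (- (a * dotp p x)) *: g.
    by rewrite /red scalerDr !scalerA scaleNr addrK.
  apply: CD => //; apply: CZ => //.
  by rewrite oppr_ge0 mulr_ge0_le0 // ltW.
Qed.

(** A basis for the first [n] coordinates also serves for the elements whose
    coordinate [n] is at least as large as in all of this basis; the others lie in
    finitely many slices, each of which has a basis. *)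
Lemma dickson (U : eqType) (e : nat -> U -> nat) (n : nat) (P : U -> Prop) :
  exists B : seq U, (forall b, b \in B -> P b) /\
    forall f, P f -> exists2 b, b \in B & forall k, (k < n)%N -> (e k b <= e k f)%N.
Proof.
elim: n P => [|n IH] P.
  have [[f Pf]|h] := pselect (exists f, P f).
    exists [:: f]; split=> [b|g Pg]; first by rewrite inE => /eqP->.
    by exists f; rewrite ?inE.
  by exists [::]; split=> // f Pf; case: h; exists f.
have [B [BP Bdom]] := IH P.
have [A hA] : exists A, forall b, b \in B -> (e n b <= A)%N.
  exists (\max_(b <- B) e n b) => b bB.
  by rewrite (big_rem b bB) /= leq_maxl.
have slices N : exists B' : seq U, (forall b, b \in B' -> P b) /\
    forall f, P f -> (e n f < N)%N ->
    exists2 b, b \in B' & forall k, (k < n.+1)%N -> (e k b <= e k f)%N.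
  elim: N => [|N [B' [B'P B'd]]]; first by exists [::].
  have [B2 [B2P B2d]] := IH (fun f => P f /\ e n f = N).
  exists (B' ++ B2); split=> [b|f Pf].
    by rewrite mem_cat => /orP[/B'P|/B2P[]].
  rewrite ltnS leq_eqVlt => /orP[/eqP efN|/(B'd f Pf)[b bB bd]].
    have [b bB bd] := B2d f (conj Pf efN).
    exists b; rewrite ?mem_cat ?bB ?orbT // => k.
    rewrite ltnS leq_eqVlt => /orP[/eqP->|/bd//].
    by rewrite efN; case: (B2P b bB) => _ ->.
  by exists b; rewrite ?mem_cat ?bB.
have [B' [B'P B'd]] := slices A.
exists (B ++ B'); split=> [b|f Pf]; first by rewrite mem_cat => /orP[/BP|/B'P].
have [fA|Af] := ltnP (e n f) A.
  by have [b bB bd] := B'd f Pf fA; exists b; rewrite ?mem_cat ?bB ?orbT.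
have [b bB bd] := Bdom f Pf; exists b; rewrite ?mem_cat ?bB // => k.
rewrite ltnS leq_eqVlt => /orP[/eqP->|/bd//].
exact: leq_trans (hA b bB) Af.
Qed.

Lemma nonroot_nat (K : numFieldType) (ps : seq {poly K}) (m : nat) :
  (forall p, p \in ps -> p != 0) ->
  exists2 N, (m <= N)%N & forall p, p \in ps -> p.[N%:R] != 0.
Proof.
move=> ps0; pose q := \prod_(p <- ps) p.
have q0 : q != 0 by rewrite prodf_seq_neq0; apply/allP => p /ps0.
have [/allP h|/allPn[N]] :=
  boolP (all (fun N : nat => root q N%:R) (iota m (size q))).
  have /= := max_poly_roots (rs := [seq N%:R | N <- iota m (size q)]) q0.
  rewrite size_map size_iota ltnn => max_roots.
  suff: false by []; apply: max_roots; first by rewrite all_map; apply/allP.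
  rewrite map_inj_uniq ?iota_uniq // => a b /eqP.
  by rewrite eqr_nat => /eqP.
rewrite mem_iota => /andP[mN _] rN; exists N => // p pps.
apply: contraNneq rN => pN; rewrite /root /q horner_prod.
by rewrite (big_rem p pps) /= pN mul0r.
Qed.

(** Weights with increasing powers of a number that avoids finitely many roots
    put a positive combination of [G] off the hyperplanes of [ps]. *)
Lemma generic_comb (K : numFieldType) n (G ps : seq 'rV[K]_n) :
  (forall p, p \in ps -> exists2 g, g \in G & dotp p g != 0) ->
  exists s : nat, (0 < s)%N /\ forall p, p \in ps ->
    dotp p (\sum_(k < size G) (s ^ k)%:R *: nth 0 G k) != 0.
Proof.
move=> psG; pose Q p := \sum_(k < size G) dotp p (nth 0 G k) *: 'X^k : {poly K}.
have [|s s0 hs] := @nonroot_nat K (map Q ps) 1.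
  move=> _ /mapP[p /psG[g gG pg] ->].
  apply/eqP => /(congr1 (fun q : {poly K} => q`_(index g G))).
  rewrite coef0 coef_sum; have ig : (index g G < size G)%N by rewrite index_mem.
  rewrite (bigD1 (Ordinal ig)) //= coefZ coefXn eqxx mulr1 nth_index // big1.
    by move/eqP; rewrite addr0 (negPf pg).
  move=> k /eqP kg; rewrite coefZ coefXn; case: eqP => [e|]; last by rewrite mulr0.
  by case: kg; apply: val_inj.
exists s; split=> // p /(map_f Q)/hs; congr (_ != 0).
rewrite /Q horner_sum dotp_sumr; apply: eq_bigr => k _.
by rewrite hornerZ hornerXn dotpZr natrX mulrC.
Qed.

(** * Cones *)

Section Lattice.
Variables (R : realType) (n : nat).
Implicit Types (a b : 'rV[int]_n).

Lemma ofZD a b : ofZ R (a + b) = ofZ R a + ofZ R b.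
Proof. by apply/rowP => i; rewrite !mxE intrD. Qed.

Lemma ofZZ z a : ofZ R (z *: a) = z%:~R *: ofZ R a.
Proof. by apply/rowP => i; rewrite !mxE intrM. Qed.

Lemma ofZN a : ofZ R (- a) = - ofZ R a.
Proof. by apply/rowP => i; rewrite !mxE intrN. Qed.

Lemma ofZ0 : ofZ R (0 : 'rV[int]_n) = 0.
Proof. by apply/rowP => i; rewrite !mxE. Qed.

Lemma ofZB a b : ofZ R (a - b) = ofZ R a - ofZ R b.
Proof. by rewrite ofZD ofZN. Qed.

Lemma ofZMn a k : ofZ R (a *+ k) = k%:R *: ofZ R a.
Proof. by apply/rowP => i; rewrite !mxE mulmxnE rmorphMn /= mulr_natl. Qed.

Lemma ofZ_inj : injective (@ofZ R n).
Proof.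
by move=> a b /rowP h; apply/rowP => i; have := h i; rewrite !mxE => /intr_inj.
Qed.

Lemma ofZ_sub_neq0 a b : a != b -> ofZ R (b - a) != 0.
Proof.
apply: contra_neq => ab0; apply/eqP; rewrite eq_sym -subr_eq0.
by apply/eqP/ofZ_inj; rewrite ofZ0.
Qed.

Lemma dotp_ofZ a b : dotp (ofZ R a) (ofZ R b) = (dotp a b)%:~R.
Proof.
by rewrite /dotp rmorph_sum; apply: eq_bigr => i _; rewrite !mxE -intrM.
Qed.

End Lattice.

Section ConicHull.
Variables (R : realType) (n : nat) (G : seq 'rV[int]_n).
Implicit Types (x y p : 'rV[R]_n).
Local Notation hull := (conic_hull (R := R) G).

Lemma hull0 : hull 0.
Proof.
by exists (fun=> 0) => // ; rewrite big1 // => v _; rewrite scale0r.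
Qed.

Lemma hullD x y : hull x -> hull y -> hull (x + y).
Proof.
move=> [c c0 ->] [d d0 ->]; exists (fun v => c v + d v).
  by move=> v; rewrite addr_ge0.
by rewrite -big_split; apply: eq_bigr => v _; rewrite scalerDl.
Qed.

Lemma hullZ a x : 0 <= a -> hull x -> hull (a *: x).
Proof.
move=> a0 [c c0 ->]; exists (fun v => a * c v) => [v|]; first exact: mulr_ge0.
by rewrite scaler_sumr; apply: eq_bigr => v _; rewrite scalerA.
Qed.

Lemma hull_gen g : g \in G -> hull (ofZ R g).
Proof.
move=> gG; pose N := count_mem g G.
have N0 : N%:R != 0 :> R by rewrite pnatr_eq0 -lt0n -has_count has_pred1.
exists (fun v => (v == g)%:R / N%:R); first by move=> v; rewrite divr_ge0.
transitivity (\sum_(v <- G | v == g) N%:R^-1 *: ofZ R g).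
  rewrite big_const_seq iter_addr_0 -[count _ _]/N -scaler_nat scalerA.
  by rewrite divff // scale1r.
rewrite big_mkcond; apply: eq_bigr => v _; case: eqP => [->|_].
  by rewrite mul1r.
by rewrite mul0r scale0r.
Qed.

Lemma hull_convex t x y : 0 <= t <= 1 -> hull x -> hull y ->
  hull (t *: x + (1 - t) *: y).
Proof.
by case/andP=> t0 t1 hx hy; apply: hullD; apply: hullZ; rewrite ?subr_ge0.
Qed.

Lemma hull_dual p : (forall g, g \in G -> 0 <= dotp p (ofZ R g)) ->
  forall x, hull x -> 0 <= dotp p x.
Proof.
move=> pG _ [c c0 ->]; rewrite dotp_sumr big_seq sumr_ge0 // => g /pG pg.
by rewrite dotpZr mulr_ge0.
Qed.

Lemma hull_perp p : (forall g, g \in G -> dotp p (ofZ R g) = 0) ->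
  forall x, hull x -> dotp p x = 0.
Proof.
move=> pG _ [c c0 ->]; rewrite dotp_sumr big_seq big1 // => g /pG pg.
by rewrite dotpZr pg mulr0.
Qed.

(** The points of a face are combinations of the generators in this face. *)
Lemma hull_face_perp e p x : (forall y, hull y -> 0 <= dotp e y) ->
  (forall g, g \in G -> dotp e (ofZ R g) = 0 -> dotp p (ofZ R g) = 0) ->
  hull x -> dotp e x = 0 -> dotp p x = 0.
Proof.
move=> e0 ep [c c0 ->]; rewrite !dotp_sumr => sum0.
rewrite big_seq big1 // => g gG; rewrite dotpZr.
have [/(ep g gG)->|eg] := eqVneq (dotp e (ofZ R g)) 0; first by rewrite mulr0.
move/eqP: sum0; rewrite big_seq psumr_eq0 => [/allP/(_ g gG)|h hG].
  by rewrite gG /= dotpZr mulf_eq0 (negPf eg) orbF => /eqP->; rewrite mul0r.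
by rewrite dotpZr mulr_ge0 // e0 //; exact: hull_gen.
Qed.

Lemma hull_separation x : ~ hull x ->
  exists p, (forall y, hull y -> 0 <= dotp p y) /\ dotp p x < 0.
Proof.
move=> nx; have [|[p [pG px]]|[a a0 ax]] :=
  @farkas R n hull hull0 hullD hullZ (map (@ofZ R n) G) x.
- by move=> _ /mapP[g gG ->]; exact: hull_gen.
- by exists p; split=> //; apply: hull_dual => g gG; apply/pG/map_f.
- case: nx; rewrite -[x]scale1r -(@mulVf _ a) ?gt_eqF // -scalerA.
  by apply: hullZ => //; rewrite invr_ge0 ltW.
Qed.

(** A functional that separates [w] from the cone would still do so a little
    further along the ray. *)
Lemma hull_closed w u :
  (forall d, 0 < d -> exists2 e, 0 < e <= d & hull (w + e *: u)) -> hull w.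
Proof.
move=> h; apply: contrapT => /hull_separation[p [pG pw]].
pose d := - dotp p w / (2 * (`|dotp p u| + 1)).
have M0 : 0 < `|dotp p u| + 1 by rewrite ltr_wpDl.
have d0 : 0 < d by rewrite divr_gt0 ?oppr_gt0 // mulr_gt0.
have [e /andP[e0 ed] /pG] := h d d0; rewrite !dotpE leNgt => /negP[].
have : e * dotp p u <= d * (`|dotp p u| + 1).
  apply: le_trans (_ : e * (`|dotp p u| + 1) <= _); last by rewrite ler_pM2r.
  by rewrite ler_pM2l // (le_trans (ler_norm _)) // lerDl.
have -> : d * (`|dotp p u| + 1) = - dotp p w / 2.
  by rewrite /d; field; rewrite gt_eqF.
lra.
Qed.

End ConicHull.

Definition full (R : realType) n (C : 'rV[R]_n -> Prop) :=
  forall p, (forall x, C x -> dotp p x = 0) -> p = 0.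

Definition interior_pt (R : realType) n (C : 'rV[R]_n -> Prop) (a : 'rV[R]_n) :=
  forall x, exists2 e, 0 < e & forall d, 0 <= d <= e -> C (a + d *: x).

Lemma interior_ptD (R : realType) n (G : seq 'rV[int]_n) (a v : 'rV[R]_n) :
  interior_pt (conic_hull G) a -> conic_hull G v ->
  interior_pt (conic_hull G) (v + a).
Proof.
move=> aI vG x; have [e e0 he] := aI x; exists e => // d /he h.
by rewrite -addrA; exact: hullD.
Qed.

Lemma interior_pt_in (R : realType) n (C : 'rV[R]_n -> Prop) a :
  interior_pt C a -> C a.
Proof.
move=> /(_ 0)[e e0 /(_ 0)]; rewrite scaler0 addr0; apply.
by rewrite lexx ltW.
Qed.

(** Apply the theorem of the alternative to the span, which is a cone generated
    by [G] and [- G]: a functional that is nonnegative on both vanishes. *)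
Lemma full_span (R : realType) n (G : seq 'rV[int]_n) :
  full (conic_hull (R := R) G) -> forall x : 'rV[R]_n,
  exists c : 'I_(size G) -> R, x = \sum_k c k *: ofZ R (nth 0 G k).
Proof.
move=> fG x; pose S y := exists c : 'I_(size G) -> R,
  y = \sum_k c k *: ofZ R (nth 0 G k).
have S0 : S 0 by exists (fun=> 0); rewrite big1 // => k; rewrite scale0r.
have SD y z : S y -> S z -> S (y + z).
  move=> [c ->] [d ->]; exists (fun k => c k + d k).
  by rewrite -big_split; apply: eq_bigr => k _; rewrite scalerDl.
have SZ a y : S y -> S (a *: y).
  move=> [c ->]; exists (fun k => a * c k).
  by rewrite scaler_sumr; apply: eq_bigr => k _; rewrite scalerA.
have SG g : g \in G -> S (ofZ R g).
  move=> gG; have ig : (index g G < size G)%N by rewrite index_mem.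
  exists (fun k => (k == Ordinal ig)%:R); rewrite (bigD1 (Ordinal ig)) //=.
  rewrite eqxx scale1r nth_index // big1 ?addr0 // => k /negPf->.
  by rewrite scale0r.
have [|[p [pG px]]|[a a0 /(SZ a^-1)]] := @farkas R n S S0 SD (fun a y _ => @SZ a y)
  (map (@ofZ R n) G ++ map (fun g => - ofZ R g) G) x.
- move=> g; rewrite mem_cat => /orP[] /mapP[h /SG hS ->] //.
  by rewrite -scaleN1r; exact: SZ.
- move: px; rewrite (fG p) ?dotp0l ?ltxx //; apply: hull_perp => g gG.
  apply/eqP; rewrite eq_le -oppr_ge0 -dotpNr.
  by rewrite !pG // mem_cat ?map_f ?orbT // (map_f (fun g => - ofZ R g)) ?orbT.
- by rewrite scalerA mulVf ?gt_eqF // scale1r.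
Qed.

(** With positive weights on all generators a combination is interior. *)
Lemma interior_generic (R : realType) n (G : seq 'rV[int]_n) (ps : seq 'rV[R]_n) :
  full (conic_hull (R := R) G) -> (forall p, p \in ps -> p != 0) ->
  exists a : 'rV[int]_n, interior_pt (conic_hull G) (ofZ R a) /\
    forall p, p \in ps -> dotp p (ofZ R a) != 0.
Proof.
move=> fG ps0; have [p /ps0 p0|s [s0 hs]] := @generic_comb R n (map (@ofZ R n) G) ps.
  apply: contrapT => h; case/eqP: p0; apply: fG; apply: hull_perp => g gG.
  apply/eqP; apply: contrapT => /negP pg.
  by apply: h; exists (ofZ R g) => //; exact: map_f.
pose a := \sum_(k < size G) (s ^ k)%:Z *: nth 0 G k.
have aE : ofZ R a = \sum_(k < size G) (s ^ k)%:R *: ofZ R (nth 0 G k).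
  rewrite /a (big_morph _ (@ofZD R n) (@ofZ0 R n)).
  by apply: eq_bigr => k _; rewrite ofZZ.
exists a; split; last first.
  move=> p /hs; rewrite aE size_map; congr (dotp _ _ != 0).
  by apply: eq_bigr => k _; rewrite (nth_map 0).
move=> x; have [c ->] := full_span fG x.
pose M := 1 + \sum_k `|c k|.
have M0 : 0 < M by rewrite ltr_pwDl // sumr_ge0.
exists M^-1 => [|d /andP[d0 dM]]; first by rewrite invr_gt0.
rewrite aE scaler_sumr -big_split /=; apply: (big_ind (conic_hull G)).
- exact: hull0.
- exact: hullD.
move=> k _; rewrite scalerA -scalerDl; apply: hullZ; last exact/hull_gen/mem_nth.
have cM : `|c k| <= M.
  rewrite /M (bigD1 k) //= addrCA lerDl addr_ge0 // sumr_ge0 //.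
have : d * `|c k| <= 1.
  apply: le_trans (_ : M^-1 * M <= 1); last by rewrite mulVf ?gt_eqF.
  exact: ler_pM.
have : 1 <= (s ^ k)%:R :> R by rewrite ler1n expn_gt0 s0.
have := ler_norm (- (d * c k)); rewrite normrN normrM (ger0_norm d0).
lra.
Qed.

(** * Finite convex coverings along a ray *)

Section RayCover.
Variables (R : realType) (n : nat).

Lemma small_all (I : finType) (P : I -> R -> Prop) :
  (forall i, exists2 d, 0 < d & forall e, 0 < e <= d -> P i e) ->
  exists2 d, 0 < d & forall i e, 0 < e <= d -> P i e.
Proof.
move=> h; suff [d d0 hd] : exists2 d, 0 < d &
    forall i, i \in enum I -> forall e, 0 < e <= d -> P i e.
  by exists d => // i; apply: hd; rewrite mem_enum.
elim: (enum I) => [|i r [d d0 hd]]; first by exists 1.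
have [d' d'0 hd'] := h i; exists (Num.min d d'); first by rewrite lt_min d0.
move=> j; rewrite inE => /orP[/eqP->|jr] e /andP[e0].
  by rewrite le_min => /andP[_ ed']; apply: hd'; rewrite e0.
by rewrite le_min => /andP[ed _]; apply: hd => //; rewrite e0.
Qed.

(** Each of the convex sets meets the ray in an interval, which either starts at
    [w] or misses a neighbourhood of [w]; finitely many of the second kind do not
    cover the ray near [w]. *)
Lemma ray_cover (I : finType) (C : I -> 'rV[R]_n -> Prop) (w u : 'rV[R]_n) :
  (forall i t x y, 0 <= t <= 1 -> C i x -> C i y -> C i (t *: x + (1 - t) *: y)) ->
  (forall x, exists i, C i x) ->
  exists i d, 0 < d /\ forall e, 0 < e <= d -> C i (w + e *: u).
Proof.
move=> conv cov; apply: contrapT => h.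
have out i d : 0 < d -> exists2 e, 0 < e <= d & ~ C i (w + e *: u).
  move=> d0; apply: contrapT => h'; apply: h; exists i, d; split=> // e ed.
  by apply: contrapT => nC; apply: h'; exists e.
have [|d d0 hd] := @small_all I (fun i e => ~ C i (w + e *: u)).
  move=> i; have [[e1 [e10 Ce1]]|no] := pselect (exists e, 0 < e /\ C i (w + e *: u)).
    have [e2 /andP[e20 e21] nC] := out i e1 e10.
    exists e2 => // e /andP[e0 ee2] Ce; apply: nC.
    have [e12|e12] := eqVneq e e1.
      by have -> : e2 = e1 by apply/eqP; rewrite eq_le e21 -e12 ee2.
    have d0 : 0 < e1 - e by rewrite subr_gt0 lt_neqAle e12 (le_trans ee2).
    pose t := (e2 - e) / (e1 - e).
    have -> : w + e2 *: u = t *: (w + e1 *: u) + (1 - t) *: (w + e *: u).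
      rewrite !scalerDr !scalerA addrACA -!scalerDl [t + _]addrC subrK scale1r.
      by congr (w + _ *: u); rewrite /t; field; rewrite gt_eqF.
    apply: conv => //; rewrite /t divr_ge0 ?subr_ge0 ?(ltW d0) //=.
      by rewrite ler_pdivrMr // mul1r lerB.
    by rewrite (le_trans ee2).
  by exists 1 => // e /andP[e0 _] Ce; apply: no; exists e.
have [i Ci] := cov (w + d *: u).
by apply: (hd i d) => //; rewrite d0 lexx.
Qed.

End RayCover.

(** * Convexity on complete fans *)

Section FanGeometry.
Variables (R : realType) (n : nat) (X : fan R n).
Local Notation s := (fan_size X).
Local Notation cone := (@fan_cone R n X).
Local Notation gens := (@fan_gens R n X).
Implicit Types (i j l : 'I_s) (u v w x p : 'rV[R]_n).

Definition fullc i := full (cone i).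

Lemma convex_dual (p : 'rV[R]_n) i :
  (forall g, g \in gens i -> 0 <= dotp p (ofZ R g)) ->
  forall x, cone i x -> 0 <= dotp p x.
Proof. exact: hull_dual. Qed.

Lemma full_gen i p : fullc i -> p != 0 ->
  exists2 g, g \in gens i & dotp p (ofZ R g) != 0.
Proof.
move=> fi p0; apply: contrapT => h; case/eqP: p0; apply: fi; apply: hull_perp.
by move=> g gG; apply/eqP; apply: contrapT => /negP pg; apply: h; exists g.
Qed.

Hypothesis hX : complete_fan X.

(** Move from [x] in a direction [g] that lies in none of finitely many hyperplanes
    that contain the lower-dimensional cones: only a full-dimensional cone can contain an
    interval of this ray, and it is closed. *)
Lemma full_cover x : exists2 i, fullc i & cone i x.
Proof.
have /choice[p hp] : forall i, exists q : 'rV[R]_n, ~ fullc i ->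
    q != 0 /\ forall y, cone i y -> dotp q y = 0.
  move=> i; have [fi|nfi] := pselect (fullc i); first by exists 0.
  apply: contrapT => h; apply: nfi => q qi; apply/eqP; apply: contrapT => /negP q0.
  by apply: h; exists q.
pose ps := [seq p i | i <- [seq i <- enum 'I_s | ~~ `[< fullc i >]]].
have [q|t [_ ht]] := @generic_comb R n [seq delta_mx 0 k | k <- enum 'I_n] ps.
  case/mapP=> i; rewrite mem_filter => /andP[/asboolPn/hp[/eqP q0 _] _] ->.
  have [k qk] : exists k, p i 0 k != 0.
    apply: contrapT => h; apply: q0; apply/rowP => k; rewrite mxE; apply/eqP.
    by apply: contrapT => /negP pk; apply: h; exists k.
  by exists (delta_mx 0 k); rewrite ?dotp_delta // map_f // mem_enum.
set g := \sum_(_ < _) _ in ht.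
have [|i [d [d0 hd]]] := @ray_cover R n 'I_s cone x g _ hX.
  by move=> i; exact: hull_convex.
exists i; last first.
  apply: (@hull_closed _ _ _ x g) => e e0; exists (Num.min e d).
    by rewrite lt_min e0 d0 ge_min lexx.
  by apply: hd; rewrite lt_min e0 d0 ge_min lexx orbT.
apply: contrapT => nfi; have [_ pi] := hp i nfi.
have /ht/eqP[] : p i \in ps.
  by rewrite map_f // mem_filter mem_enum andbT; apply/asboolPn.
have d2 : 0 < d / 2 <= d by rewrite divr_gt0 // ler_pdivrMr // ler_peMr ?ler1n // ltW.
have := pi _ (hd _ d2); have := pi _ (hd d _); rewrite d0 lexx !dotpE => /(_ isT).
move=> e1 e2; have : d * dotp (p i) g = 0 by lra.
by move/eqP; rewrite mulf_eq0 gt_eqF //= => /eqP.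
Qed.

Lemma full_ray w u : exists i, [/\ fullc i, cone i w &
  exists2 d, 0 < d & forall e, 0 < e <= d -> cone i (w + e *: u)].
Proof.
have [||i [d [d0 hd]]] :=
  @ray_cover R n 'I_s (fun i x => fullc i /\ cone i x) w u.
- by move=> i t x y t01 [fi xi] [_ yi]; split=> //; exact: hull_convex.
- by move=> x; have [i fi xi] := full_cover x; exists i.
exists i; split; first by have [] := hd d; rewrite ?d0 ?lexx.
  apply: (@hull_closed _ _ _ w u) => e e0; exists (Num.min e d).
    by rewrite lt_min e0 d0 ge_min lexx.
  by apply: (hd _ _).2; rewrite lt_min e0 d0 ge_min lexx orbT.
by exists d => // e /hd[].
Qed.

(** Along the segment from [a] to the interior point [a + u] of [cone j], leave
    the current cone at the last possible time and enter one that continues.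
    Slopes only decrease at the crossings, so the values of the last linear
    function [r j] dominate those of the first one. *)
Lemma walk (r : 'I_s -> 'rV[R]_n) (a u : 'rV[R]_n) j i t t' :
  (forall i l x, fullc i -> fullc l -> cone i x -> cone l x ->
    dotp (r i) x = dotp (r l) x) ->
  fullc j -> interior_pt (cone j) (a + u) ->
  (forall i l t e e', fullc i -> fullc l -> t < 1 -> 0 < e -> 0 < e' ->
    cone i (a + t *: u) -> cone l (a + t *: u) ->
    cone i (a + t *: u - e *: u) -> cone l (a + t *: u + e' *: u) ->
    dotp (r l - r i) u <= 0) ->
  fullc i -> t < t' <= 1 ->
  cone i (a + t *: u) -> cone i (a + t' *: u) ->
  dotp (r j - r i) u <= 0 /\ 0 <= dotp (r j - r i) (a + t *: u).
Proof.
move=> compat fj bj cross.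
pose beyond t := [set l | `[< exists2 t', t < t' <= 1 & cone l (a + t' *: u) >]].
move: {2}#|beyond t|.+1 (ltnSn #|beyond t|) => m.
elim: m i t t' => // m IH i t t' hm fi /andP[tt' t'1] it it'.
pose E : set R := [set z | t <= z <= 1 /\ cone i (a + z *: u)]%classic.
have Et' : E t' by split=> //; rewrite t'1 ltW.
have hE : has_sup E by split; [exists t'|exists 1 => z [/andP[]]].
pose S := sup E.
have ubS z : E z -> z <= S by move=> Ez; apply: ub_le_sup => //; exact: hE.2.
have S1 : S <= 1 by apply: ge_sup; [exists t'|move=> z [/andP[]]].
have t'S : t' <= S by exact: ubS.
have tS : t < S by exact: lt_le_trans t'S.
have iS : cone i (a + S *: u).
  apply: contrapT => nS; apply: (nS); apply: (@hull_closed _ _ _ _ (- u)) => d d0.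
  have [z Ez Sz] := sup_adherent d0 hE; have [zS|zS] := eqVneq z S.
    by case: nS; rewrite -zS; case: Ez.
  exists (S - z).
    by rewrite subr_gt0 lt_neqAle zS ubS //= lerBlDr addrC -lerBlDr ltW.
  have [_ ] := Ez; congr (conic_hull _ _).
  by apply/rowP => k; rewrite !mxE; ring.
have [S1'|S1'] := eqVneq S 1.
  have [e e0 he] := bj (- u).
  pose d := Num.min e (1 - t).
  have d0 : 0 < d by rewrite lt_min e0 subr_gt0 -S1'.
  have jd : cone j (a + u - d *: u).
    by rewrite -scalerN; apply: he; rewrite (ltW d0) ge_min lexx.
  have ib : cone i (a + u) by rewrite -[X in _ + X]scale1r -S1'.
  have idd : cone i (a + u - d *: u).
    pose z := d / (1 - t).
    have z01 : 0 <= z <= 1.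
      have t1 : 0 < 1 - t by rewrite subr_gt0 -S1'.
      by rewrite /z divr_ge0 ?(ltW d0) ?(ltW t1) //= ler_pdivrMr // mul1r
        ge_min lexx orbT.
    have -> : a + u - d *: u = z *: (a + t *: u) + (1 - z) *: (a + u).
      apply/rowP => k; rewrite !mxE /z; field.
      by rewrite subr_eq0 gt_eqF // -S1'.
    exact: hull_convex.
  have jb : cone j (a + u) by exact: interior_pt_in.
  have := compat _ _ _ fi fj idd jd; have := compat _ _ _ fi fj ib jb.
  rewrite !dotpE => e1 e2.
  have e3 : dotp (r i) u = dotp (r j) u.
    have : d * (dotp (r i) u - dotp (r j) u) = 0 by lra.
    by move/eqP; rewrite mulf_eq0 gt_eqF //= subr_eq0 => /eqP.
  by rewrite e3; split; [rewrite subrr|lra].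
have {S1'}S1 : S < 1 by rewrite lt_neqAle S1'.
have [l [fl lS [d d0 hd]]] := full_ray (a + S *: u) u.
pose e := Num.min d (1 - S).
have e0 : 0 < e by rewrite lt_min d0 subr_gt0.
have lSe : cone l (a + (S + e) *: u).
  by rewrite scalerDl addrA; apply: hd; rewrite e0 ge_min lexx.
have [|||||slope val] := IH l S (S + e).
- rewrite -ltnS; apply: leq_trans hm; rewrite ltnS; apply: proper_card.
  apply/fintype.properP; split.
    apply/fintype.subsetP => k; rewrite !inE => -[z /andP[Sz z1] kz].
    by exists z => //; rewrite z1 (lt_trans tS).
  exists i; first by rewrite !inE; exists S; rewrite ?tS ?ltW.
  apply/negP; rewrite !inE => -[z /andP[Sz z1] iz].
  suff /ubS : E z by rewrite leNgt Sz.
  by split=> //; rewrite z1 andbT ltW // (lt_trans tS).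
- exact: fl.
- by rewrite ltrDl e0 /= -lerBrDl ge_min lexx orbT.
- exact: lS.
- exact: lSe.
have il : dotp (r l - r i) u <= 0.
  apply: (cross i l S (S - t) e) => //; rewrite ?subr_gt0 //.
    by move: it; congr (conic_hull _ _); apply/rowP => k; rewrite !mxE; ring.
  by rewrite -addrA -scalerDl.
have := compat _ _ _ fi fl iS lS; move: slope val il; rewrite !dotpE.
move=> h1 h2 h3 h4; split; first by lra.
have : (S - t) * (dotp (r j) u - dotp (r i) u) <= 0.
  by rewrite pmulr_rle0 ?subr_gt0 //; lra.
lra.
Qed.

End FanGeometry.
(** * Concave integral support functions *)

Section SupportFunctions.
Variables (R : realType) (n : nat) (X : fan R n).
Local Notation s := (fan_size X).
Local Notation cone := (@fan_cone R n X).
Local Notation gens := (@fan_gens R n X).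
Implicit Types (i j l : 'I_s) (m q : 'I_s -> 'rV[int]_n).

(** Together with a point [b], this says that [cone i] and [cone l] meet along
    a wall: at most one line of functionals vanishes on the intersection, and
    the hyperplane of the wall does not contain [b]. *)
Definition wall i l (b : 'rV[int]_n) := forall p : 'rV[R]_n,
  (forall x, cone i x -> cone l x -> dotp p x = 0) ->
  dotp p (ofZ R b) = 0 -> p = 0.

Lemma wall_collinear i l b (p p' : 'rV[R]_n) : wall i l b ->
  (forall x, cone i x -> cone l x -> dotp p x = 0) ->
  (forall x, cone i x -> cone l x -> dotp p' x = 0) ->
  p != 0 -> p' = (dotp p' (ofZ R b) / dotp p (ofZ R b)) *: p.
Proof.
move=> W hp hp' p0; have pb : dotp p (ofZ R b) != 0.
  by apply: contraNneq p0 => /(W _ hp)->.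
apply/eqP; rewrite -subr_eq0; apply/eqP; apply: W => [x xi xl|].
  by rewrite !dotpE (hp x) // (hp' x) //; ring.
by rewrite !dotpE; field.
Qed.

(** Concavity of the piecewise linear function given by [m i] on [cone i], stated
    as global inequalities between the maximal cones.  These are finitely many
    integral linear inequalities, and they entail that the linear functions agree
    on the intersections. *)
Definition nef_tuple m := forall i j, fullc i -> fullc j ->
  forall g, g \in gens i -> 0 <= dotp (m j - m i) g.

Definition compatible m := forall i j x, cone i x -> cone j x ->
  dotp (ofZ R (m i)) x = dotp (ofZ R (m j)) x.

(** The lattice points of [divisor_polytope m], by finitely many inequalities. *)
Definition in_polytope m (p : 'rV[int]_n) := forall i, fullc i ->
  forall g, g \in gens i -> 0 <= dotp (p - m i) g.

Lemma nef_tuple_ge0 m i j : nef_tuple m -> fullc i -> fullc j ->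
  forall x, cone i x -> 0 <= dotp (ofZ R (m j - m i)) x.
Proof.
move=> mN fi fj; apply: convex_dual => g gG; rewrite dotp_ofZ ler0z.
exact: mN.
Qed.

Lemma nef_tuple_perp m i j : nef_tuple m -> fullc i -> fullc j ->
  forall x, cone i x -> cone j x -> dotp (ofZ R (m j - m i)) x = 0.
Proof.
move=> mN fi fj x xi xj; apply/eqP; rewrite eq_le (nef_tuple_ge0 mN) // andbT.
by rewrite -oppr_ge0 -dotpNl -ofZN opprB (nef_tuple_ge0 mN).
Qed.

Lemma nef_tupleD m q : nef_tuple m -> nef_tuple q ->
  nef_tuple (fun i => m i + q i).
Proof.
move=> mN qN i j fi fj g gG; rewrite opprD addrACA dotpDl.
by rewrite addr_ge0 // ?mN ?qN.
Qed.

Lemma nef_tuple_vertex m i : nef_tuple m -> fullc i -> in_polytope m (m i).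
Proof. by move=> mN fi l fl g; exact: mN. Qed.

Lemma in_polytopeD m q x y : in_polytope m x -> in_polytope q y ->
  in_polytope (fun i => m i + q i) (x + y).
Proof.
move=> mx qy i fi g gG; rewrite opprD addrACA dotpDl.
by rewrite addr_ge0 // ?mx ?qy.
Qed.

Hypothesis hX : complete_fan X.

(** The segment joining a generic point near the ray of a generator of [cone i] to
    an interior point [b] of [cone j] avoids all intersections of cones of codimension at least two, as
    these span with [b] proper subspaces. *)
Lemma local_global m :
  (forall i l x, fullc i -> fullc l -> cone i x -> cone l x ->
    dotp (ofZ R (m i)) x = dotp (ofZ R (m l)) x) ->
  (forall i l w (u b : 'rV[int]_n) e e', fullc i -> fullc l -> wall i l b ->
    cone i w -> cone l w -> 0 < e -> 0 < e' ->
    cone i (w - e *: ofZ R u) -> cone l (w + e' *: ofZ R u) ->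
    dotp (ofZ R (m l - m i)) (ofZ R u) <= 0) ->
  nef_tuple m.
Proof.
move=> compat cross i j fi fj v vi.
have [b [bj _]] := @interior_generic R n (gens j) [::] fj
  (fun p (h : p \in [::]) => match notF h with end).
(* A pair of cones is bad if a functional vanishes on the intersection and on [b];
   the segment avoids the intersection if it starts off the hyperplane. *)
pose bad (il : 'I_s * 'I_s) (p : 'rV[R]_n) := [/\ p != 0,
  forall x, cone il.1 x -> cone il.2 x -> dotp p x = 0 & dotp p (ofZ R b) = 0].
have /choice[p hp] : forall il, exists p, (exists z, bad il z) -> bad il p.
  move=> il; have [[z hz]|nz] := pselect (exists z, bad il z); first by exists z.
  by exists 0 => /nz.
pose ps := [seq z <- [seq p il | il <- enum {: 'I_s * 'I_s}] | z != 0].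
have ps0 z : z \in ps -> z != 0 by rewrite mem_filter => /andP[].
have [a0 [a0i a0ps]] := interior_generic fi ps0.
rewrite leNgt; apply/negP => rv.
pose r := ofZ R (m j - m i).
have rv1 : dotp r (ofZ R v) <= -1.
  by rewrite dotp_ofZ -(intrN _ 1) ler_int; lia.
(* [m j - m i] is negative on [v], hence also on [K v + a0] for large [K]. *)
have [K1 hK1] : exists K1 : nat, dotp r (ofZ R a0) < K1%:R.
  exists (Num.bound `|dotp r (ofZ R a0)|).
  exact: le_lt_trans (ler_norm _) (archi_boundP (normr_ge0 _)).
pose f (z : 'rV[R]_n) := (dotp z (ofZ R a0))%:P + dotp z (ofZ R v) *: 'X.
have [q|K K1K hK] := @nonroot_nat R (map f ps) K1.
  case/mapP => q' /a0ps q'0 ->; apply: contraNneq q'0 => /(congr1 (fun h => h.[0])).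
  by rewrite /f hornerD hornerC hornerZ hornerX mulr0 addr0 horner0 => ->.
pose a := K%:Z *: v + a0.
have aE : ofZ R a = K%:R *: ofZ R v + ofZ R a0 by rewrite ofZD ofZZ.
have aps z : z \in ps -> dotp z (ofZ R a) != 0.
  move=> zps; have := hK _ (map_f f zps); rewrite hornerD hornerC hornerZ hornerX.
  by rewrite aE !dotpE addrC mulrC.
have [e e0 he] : exists2 e, 0 < e & forall d, 0 <= d <= e ->
    cone i (ofZ R a + d *: ofZ R (b - a)).
  by rewrite aE; apply: interior_ptD => //; apply: hullZ => //; exact: hull_gen.
have [||i1 l1 t d d' fi1 fl1 t1 d0 d'0 i1w l1w i1d l1d|||||_] :=
    @walk R n X hX (fun i => ofZ R (m i)) (ofZ R a) (ofZ R (b - a)) j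
    i 0 (Num.min e 1) compat.
- exact: fj.
- by rewrite ofZB addrC subrK.
- rewrite -ofZB; apply: (cross i1 l1 (ofZ R a + t *: ofZ R (b - a)) (b - a) b d d') => //.
  move=> q hq qb; apply/eqP; apply: contrapT => /negP q0.
  have [p0 pil pb] : bad (i1, l1) (p (i1, l1)) by apply: hp; exists q.
  have /aps/eqP[] : p (i1, l1) \in ps.
    by rewrite mem_filter p0 map_f // mem_enum.
  have := pil _ i1w l1w; rewrite /= ofZB !dotpE pb => h.
  have : (1 - t) * dotp (p (i1, l1)) (ofZ R a) = 0 by lra.
  by move/eqP; rewrite mulf_eq0 subr_eq0 gt_eqF //= => /eqP.
- exact: fi.
- by rewrite lt_min e0 ltr01 ge_min lexx orbT.
- by apply: he; rewrite lexx ltW.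
- by apply: he; rewrite le_min ltW // ler01 ge_min lexx.
rewrite scale0r addr0 aE -ofZB -/r !dotpE => h.
have := ler_wpM2l (ler0n R K) rv1; have : K1%:R <= K%:R :> R by rewrite ler_nat.
lra.
Qed.

End SupportFunctions.

(** * Lattice points of Minkowski sums *)

Section Decomposition.
Variables (R : realType) (n : nat) (X : fan R n).
Local Notation s := (fan_size X).
Local Notation cone := (@fan_cone R n X).
Local Notation gens := (@fan_gens R n X).
Implicit Types (i j l : 'I_s) (m q : 'I_s -> 'rV[int]_n).
Hypothesis hX : complete_fan X.

(** A point outside the convex hull of the vertices is separated from it by a
    linear functional; a maximal cone containing this functional gives an
    inequality of the polytope that the point violates. *)
Lemma in_hull_vertices m (x : 'rV[int]_n) : in_polytope m x ->
  exists c : 'I_s -> R, [/\ forall i, 0 <= c i, \sum_(i | `[< fullc i >]) c i = 1 &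
    ofZ R x = \sum_(i | `[< fullc i >]) c i *: ofZ R (m i)].
Proof.
(* The last coordinate 1 turns convex combinations into conic ones. *)
move=> mx; pose V (y : 'rV[int]_n) : 'rV[R]_(n + 1) := row_mx (ofZ R y) (const_mx 1).
pose C (y : 'rV[R]_(n + 1)) := exists2 c : 'I_s -> R, (forall i, 0 <= c i) &
  y = \sum_(i | `[< fullc i >]) c i *: V (m i).
have C0 : C 0 by exists (fun=> 0) => //; rewrite big1 // => i; rewrite scale0r.
have CD y z : C y -> C z -> C (y + z).
  move=> [c c0 ->] [d d0 ->]; exists (fun i => c i + d i).
    by move=> i; rewrite addr_ge0.
  by rewrite -big_split; apply: eq_bigr => i _; rewrite scalerDl.
have CZ a y : 0 <= a -> C y -> C (a *: y).
  move=> a0 [c c0 ->]; exists (fun i => a * c i) => [i|]; first exact: mulr_ge0.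
  by rewrite scaler_sumr; apply: eq_bigr => i _; rewrite scalerA.
have [|[p [pG px]]|[a a0 [c c0 ac]]] := @farkas R _ C C0 CD CZ
    [seq V (m i) | i <- enum 'I_s & `[< fullc i >]] (V x).
- move=> g0 /mapP[i]; rewrite mem_filter => /andP[fi _] ->.
  exists (fun j => (j == i)%:R); first by move=> j; rewrite ler0n.
  rewrite (bigD1 i) //= eqxx scale1r big1 ?addr0 // => j /andP[_ /negPf->].
  by rewrite scale0r.
- exfalso; have [i fi pi] := full_cover hX (lsubmx p).
  have /pG : V (m i) \in [seq V (m i) | i <- enum 'I_s & `[< fullc i >]].
    apply: (map_f (fun i => V (m i))).
    by rewrite mem_filter mem_enum andbT; apply/asboolP.
  have dpE y : dotp p (V y) =
      dotp (lsubmx p) (ofZ R y) + dotp (rsubmx p) (const_mx 1).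
    by rewrite -[p in LHS]hsubmxK dotp_row_mx.
  move: px; rewrite !dpE => px pm.
  have : 0 <= dotp (ofZ R (x - m i)) (lsubmx p).
    apply: (convex_dual (i := i)) => // g gG; rewrite dotp_ofZ ler0z.
    exact: mx.
  by rewrite ofZB dotpC dotpBr; lra.
have cE i : a^-1 * (a * c i) = c i by rewrite mulKf // gt_eqF.
have VE : V x = \sum_(i | `[< fullc i >]) (a^-1 * c i) *: V (m i).
  rewrite -[V x]scale1r -(@mulVf _ a) ?gt_eqF // -scalerA ac scaler_sumr.
  by apply: eq_bigr => i _; rewrite scalerA.
exists (fun i => a^-1 * c i); split.
- by move=> i; rewrite mulr_ge0 // invr_ge0 ltW.
- have /(congr1 (fun y => rsubmx y 0 0)) := VE.
  rewrite row_mxKr mxE raddf_sum summxE => ->; apply: eq_bigr => i _.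
  by rewrite /= mxE mxE row_mxEr mxE mulr1.
- have /(congr1 lsubmx) := VE; rewrite row_mxKl raddf_sum => ->.
  by apply: eq_bigr => i _; apply/rowP => k; rewrite /= mxE mxE row_mxEl [RHS]mxE.
Qed.

(** Write [x] as a convex combination of the vertices [m i + q i].  Some
    coefficient [c i] is at least [1 / s], and then [x - q i] satisfies the
    inequalities of the polytope of [m]: the term [c i * (m i - m l)] gains at
    least [c i * s * (q i - q l)] on [cone l], as [m - s q] is nef. *)
Lemma translates_cover m q (x : 'rV[int]_n) : nef_tuple m -> nef_tuple q ->
  nef_tuple (fun i => m i - q i *+ s) -> in_polytope (fun i => m i + q i) x ->
  exists2 i, fullc i & in_polytope m (x - q i).
Proof.
move=> mN qN mqN /in_hull_vertices[c [c0 c1 xE]].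
have [i fi ci] : exists2 i, fullc i & 1 <= c i * s%:R.
  apply: contrapT => h.
  have lt1 i : `[< fullc i >] -> c i * s%:R < 1.
    by move=> /asboolP fi; rewrite ltNge; apply/negP => ci; apply: h; exists i.
  have s0 : (0 < s)%N by have [[k sk] _ _] := full_cover hX 0; exact: leq_trans sk.
  have : \sum_(i | `[< fullc i >]) c i * s%:R < s%:R.
    rewrite -[X in _ < X%:R]card_ord -sum1_card natr_sum big_mkcond /=.
    have [k fk _] := full_cover hX 0.
    rewrite (bigD1 k) //= [X in _ < X](bigD1 k) //= ltr_leD //.
      by have /asboolP fk' := fk; rewrite fk' lt1.
    apply: ler_sum => l _; case: ifP => [/lt1/ltW//|_]; exact: ler01.
  by rewrite -mulr_suml c1 mul1r ltxx.
exists i => // l fl g gG.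
rewrite -(ler0z R) -dotp_ofZ !ofZB xE.
have {1}-> : \sum_(j | `[< fullc j >]) c j *: ofZ R (m j + q j) - ofZ R (q i) -
    ofZ R (m l) = \sum_(j | `[< fullc j >]) c j *: (ofZ R (m j - m l) + ofZ R (q j - q i)).
  rewrite -addrA -opprD -ofZD -[ofZ R (q i + _)]scale1r -c1 scaler_suml -sumrB.
  apply: eq_bigr => j _; rewrite -scalerBr !ofZB !ofZD; congr (_ *: _).
  by apply/rowP => k; rewrite !mxE; ring.
rewrite dotp_suml.
pose A j : R := dotp (ofZ R (m j - m l)) (ofZ R g).
pose B j : R := dotp (ofZ R (q j - q l)) (ofZ R g).
have -> : \sum_(j | `[< fullc j >])
    dotp (c j *: (ofZ R (m j - m l) + ofZ R (q j - q i))) (ofZ R g) =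
    \sum_(j | `[< fullc j >]) c j * (A j + B j) - B i.
  rewrite -[X in _ - X]mul1r -c1 mulr_suml -sumrB; apply: eq_bigr => j _.
  by rewrite /A /B !ofZB !dotpE; ring.
have A0 j : fullc j -> 0 <= A j by move=> fj; rewrite /A dotp_ofZ ler0z mN.
have B0 j : fullc j -> 0 <= B j by move=> fj; rewrite /B dotp_ofZ ler0z qN.
have AB : s%:R * B i <= A i.
  have := mqN l i fl fi g gG; rewrite -(ler0z R) -dotp_ofZ /A /B.
  rewrite !ofZB !ofZMn !dotpE; lra.
rewrite (bigD1 i) /=; last exact/asboolP.
have : 0 <= \sum_(j | `[< fullc j >] && (j != i)) c j * (A j + B j).
  by apply: sumr_ge0 => j /andP[/asboolP fj _]; rewrite mulr_ge0 // addr_ge0 ?A0 ?B0.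
have : B i <= c i * (s%:R * B i) by rewrite mulrA ler_peMl // B0.
have := ler_wpM2l (c0 i) AB; have := mulr_ge0 (c0 i) (B0 i fi).
rewrite mulrDr; lra.
Qed.

Definition nef_ineqs :=
  [seq t <- [seq (il, g) | il <- enum {: 'I_s * 'I_s}, g <- gens il.1] |
  `[< fullc t.1.1 /\ fullc t.1.2 >]].
Definition ineq_value q (t : 'I_s * 'I_s * 'rV[int]_n) :=
  `|dotp (q t.1.2 - q t.1.1) t.2|%N.
(** How far [q] is from being linear: for nef [q] this vanishes exactly when all
    [q i] agree on the maximal cones. *)
Definition weight q := (\sum_(t <- nef_ineqs) ineq_value q t)%N.

Lemma mem_nef_ineqs i l g :
  ((i, l, g) \in nef_ineqs) <-> [/\ fullc i, fullc l & g \in gens i].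
Proof.
rewrite mem_filter; split=> [/andP[/asboolP[fi fl] /allpairsPdep]|[fi fl gG]].
  by case=> -[i' l'] [g' [_ gG [ei el eg]]]; split=> //; rewrite ei eg.
apply/andP; split; first exact/asboolP.
by apply/allpairsPdep; exists (i, l), g; rewrite mem_enum.
Qed.

(** Generation up to linear tuples, as the step of an induction on the weight. *)
Definition nef_generating (Q : seq {ffun 'I_s -> 'rV[int]_n}) :=
  (forall f : {ffun 'I_s -> 'rV[int]_n}, f \in Q -> nef_tuple (X := X) f) /\
  forall q, nef_tuple (X := X) q ->
    (forall i l, fullc i -> fullc l -> q i = q l) \/
    exists f : {ffun 'I_s -> 'rV[int]_n}, [/\ f \in Q,
      nef_tuple (X := X) (fun i => q i - f i) &
      (weight (fun i => (q i - f i)%R) < weight q)%N].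

(** A difference of nef tuples is nef as soon as the values of its inequalities are
    nonnegative, so a Dickson basis of the vectors of values is generating. *)
Lemma nef_generators : exists Q, nef_generating Q.
Proof.
pose e k (q : {ffun 'I_s -> 'rV[int]_n}) :=
  nth 0%N [seq ineq_value q t | t <- nef_ineqs] k.
have [Q [QP Qd]] := dickson e (size nef_ineqs)
  (fun q : {ffun 'I_s -> 'rV[int]_n} => nef_tuple (X := X) q /\ weight q != 0%N).
exists Q; split=> [q /QP[]//|q qN].
have [w0|w0] := eqVneq (weight q) 0%N.
  left=> i l fi fl; apply/eqP; rewrite -subr_eq0 -oppr_eq0 opprB.
  apply/eqP/(@ofZ_inj R); rewrite ofZ0; apply: (fi); apply: hull_perp => g gG.
  have : (i, l, g) \in nef_ineqs by apply/mem_nef_ineqs.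
  move/eqP: w0; rewrite /weight sum_nat_seq_eq0 => /allP h /h /=.
  by rewrite absz_eq0 dotp_ofZ => /eqP->.
right; have [|b bQ bd] := Qd (finfun q).
  split; first by move=> i l fi fl g gG; rewrite !ffunE; exact: qN.
  by move: w0; congr (_ != _); apply: eq_bigr => t _; rewrite /ineq_value !ffunE.
have [bN bw] := QP b bQ.
have dom t : t \in nef_ineqs -> (ineq_value b t <= ineq_value q t)%N.
  move=> tI; have ti : (index t nef_ineqs < size nef_ineqs)%N by rewrite index_mem.
  have := bd _ ti; rewrite /e !(nth_map t) // nth_index //.
  by rewrite /ineq_value !ffunE.
have vD t : t \in nef_ineqs -> ineq_value (fun i => q i - b i) t =
    (ineq_value q t - ineq_value b t)%N.
  case: t => -[i l] g tI; have := dom _ tI; move/mem_nef_ineqs: tI => [fi fl gG].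
  have := qN _ _ fi fl g gG; have := bN _ _ fi fl g gG; rewrite /ineq_value /=.
  have -> : q l - b l - (q i - b i) = (q l - q i) - (b l - b i).
    by rewrite !opprD !opprK addrACA.
  rewrite (dotpBl (q l - q i)).
  by move: (dotp (q l - q i) g) (dotp (b l - b i) g) => x y; lia.
exists b; split=> //.
  move=> i l fi fl g gG; have tI := (mem_nef_ineqs i l g).2 (And3 fi fl gG).
  have := dom _ tI.
  have := qN _ _ fi fl g gG; have := bN _ _ fi fl g gG; rewrite /ineq_value /=.
  have -> : q l - b l - (q i - b i) = (q l - q i) - (b l - b i).
    by rewrite !opprD !opprK addrACA.
  rewrite (dotpBl (q l - q i)).
  by move: (dotp (q l - q i) g) (dotp (b l - b i) g) => x y; lia.
have : (weight (fun i => q i - b i)%R + weight b = weight q)%N.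
  rewrite /weight -big_split big_seq [RHS]big_seq; apply: eq_bigr => t tI.
  by rewrite /= vD // subnK // dom.
by move=> <-; rewrite -[X in (X < _)%N]addn0 ltn_add2l lt0n.
Qed.

(** Split off a generator [f] from [q].  As [m - s f] is nef, so is
    [(m + (q - f)) - s f], whence [x] lies in a translate of the polytope of
    [m + (q - f)] by a vertex of the polytope of [f]. *)
Lemma minkowski_decomposition Q m q (x : 'rV[int]_n) : nef_generating Q ->
  nef_tuple m ->
  (forall f : {ffun 'I_s -> 'rV[int]_n}, f \in Q ->
    nef_tuple (X := X) (fun i => m i - f i *+ s)) ->
  nef_tuple q -> in_polytope (fun i => m i + q i) x ->
  exists a b, [/\ x = a + b, in_polytope m a & in_polytope q b].
Proof.
move=> [QN Qgen] mN mQ; move: {2}(weight q).+1 (ltnSn (weight q)) => N.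
elim: N q x => // N IH q x wq qN xP.
have [qlin|[g [gQ qgN wqg]]] := Qgen q qN.
  have [i fi _] := full_cover hX 0.
  exists (x - q i), (q i); split; [by rewrite subrK| |exact: nef_tuple_vertex].
  move=> l fl v vG; have := xP l fl v vG.
  by rewrite (qlin i l fi fl) opprD addrA addrAC.
have [||||i fi xi] := @translates_cover (fun i => m i + (q i - g i)) g x.
- exact: nef_tupleD.
- exact: QN.
- move=> i l fi fl v vG; have := nef_tupleD (mQ _ gQ) qgN fi fl vG.
  by congr (0 <= dotp _ _); rewrite ![_ + (_ - _) - _]addrAC.
- move=> i fi v vG; have := xP i fi v vG.
  by rewrite -addrA subrK.
have [|a [b [xE am bq]]] := IH _ _ _ qgN xi.
  by apply: leq_trans wqg _; rewrite -ltnS.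
exists a, (b + g i); split=> //; first by rewrite addrA -xE subrK.
have := in_polytopeD bq (nef_tuple_vertex (QN g gQ) fi).
by move=> h l fl v vG; have := h l fl v vG; rewrite subrK.
Qed.

End Decomposition.

(** * Edges of the polytope *)

Section Edges.
Variables (R : realType) (n : nat) (X : fan R n).
Local Notation s := (fan_size X).
Local Notation cone := (@fan_cone R n X).
Local Notation gens := (@fan_gens R n X).
Implicit Types (i j l : 'I_s) (m q : 'I_s -> 'rV[int]_n).
Hypothesis hX : complete_fan X.

Lemma divisor_polytope_full m (p : 'rV[R]_n) : compatible (X := X) m ->
  (forall i, fullc i -> forall x, cone i x -> dotp (ofZ R (m i)) x <= dotp p x) ->
  divisor_polytope (X := X) m p.
Proof.
move=> mC h i x xi; have [l fl xl] := full_cover hX x.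
by rewrite !dotE (mC i l x xi xl); exact: h.
Qed.

(** The functional is the sum of the generators of the wall: a point of the
    polytope on its supporting hyperplane differs from [m i] by a functional
    that vanishes on the wall, hence lies on the line through [m i] and [m l];
    a generator on either side of the wall bounds it to the segment. *)
Lemma wall_edge m i l (b : 'rV[int]_n) : nef_tuple (X := X) m ->
  compatible (X := X) m -> fullc i -> fullc l -> wall i l b -> m i != m l ->
  lattice_edge (divisor_polytope (X := X) m) (m i) (m l).
Proof.
move=> mN mC fi fl W mil; split=> //.
have [e0 e0i e0cap] := fan_caps i l.
pose D := ofZ R (m l - m i).
have D0 : D != 0 by exact: ofZ_sub_neq0.
have Dperp := nef_tuple_perp mN fi fl.
pose u := \sum_(g <- gens i | dotp e0 (ofZ R g) == 0) ofZ R g.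
have uC : cone i u.
  rewrite /u big_seq_cond; apply: (big_ind (cone i)); first exact: hull0.
    exact: hullD.
  by move=> g /andP[gG _]; exact: hull_gen.
have e0u : dotp e0 u = 0 by rewrite dotp_sumr big1 // => g /eqP.
have ul : cone l u by have [] := (e0cap u).2 (conj uC e0u).
have vertex j : fullc j -> divisor_polytope (X := X) m (ofZ R (m j)).
  move=> fj; apply: divisor_polytope_full => // k fk x xk.
  by have := nef_tuple_ge0 mN fk fj xk; rewrite ofZB dotpBl subr_ge0.
exists u, (dotp u (ofZ R (m i))); split=> [p Pp|p].
  by have := Pp i u uC; rewrite !dotE dotpC (dotpC p).
rewrite dotE; split=> [[Pp pu]|[t /andP[t0 t1] ->]]; last first.
  split.
    apply: divisor_polytope_full => // k fk x xk; rewrite !dotpE.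
    have := vertex i fi k x xk; have := vertex l fl k x xk; rewrite !dotE => h1 h2.
    have h3 : 0 <= 1 - t by rewrite subr_ge0.
    have := ler_wpM2l t0 h1; have := ler_wpM2l h3 h2; lra.
  have := Dperp u uC ul; rewrite ofZB !dotpE (dotpC _ u) (dotpC _ u).
  by move/eqP; rewrite subr_eq0 => /eqP->; ring.
have pm j : fullc j -> forall g, g \in gens j -> 0 <= dotp (p - ofZ R (m j)) (ofZ R g).
  by move=> fj g gG; rewrite dotpBl subr_ge0; apply: Pp; exact: hull_gen.
have pperp x : cone i x -> cone l x -> dotp (p - ofZ R (m i)) x = 0.
  move=> xi xl; have [_] := (e0cap x).1 (conj xi xl); rewrite dotE.
  apply: (hull_face_perp e0i _ xi) => g gG e0g.
  have pu0 : \sum_(g <- gens i | dotp e0 (ofZ R g) == 0)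
      dotp (p - ofZ R (m i)) (ofZ R g) = 0.
    by rewrite -dotp_sumr dotpBl (dotpC p) pu dotpC subrr.
  move/eqP: pu0; rewrite big_seq_cond psumr_eq0; last first.
    by move=> h /andP[/pm->].
  by move/allP => /(_ g gG); rewrite gG e0g eqxx => /eqP->.
have pE := wall_collinear W Dperp pperp D0.
set t := _ / _ in pE.
exists t; last first.
  by rewrite -[p](subrK (ofZ R (m i))) pE /D ofZB; apply/rowP => k; rewrite !mxE; ring.
have [g gG Dg] := full_gen fi D0; have [h hG Dh] := full_gen fl D0.
apply/andP; split.
  have Dg0 : 0 < dotp D (ofZ R g).
    rewrite lt0r Dg (nef_tuple_ge0 mN) //; exact: hull_gen.
  by have := pm i fi g gG; rewrite pE dotpZl pmulr_lge0.
have Dh0 : dotp D (ofZ R h) < 0.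
  rewrite lt_neqAle Dh -oppr_ge0 -dotpNl -ofZN opprB (nef_tuple_ge0 mN) //.
  exact: hull_gen.
have := pm l fl h hG; have -> : p - ofZ R (m l) = (t - 1) *: D.
  by rewrite scalerBl -pE /D ofZB scale1r; apply/rowP => k; rewrite !mxE; ring.
by rewrite dotpZl nmulr_lge0 // subr_le0.
Qed.

(** Across a wall [q l - q i] is a multiple of [m l - m i].  The entries of the
    first vector are at most [C] in absolute value, and a nonzero entry of the
    second one is a multiple of the length of an edge, which is at least [s * C];
    so the factor is at most [1 / s] in absolute value. *)
Lemma long_edges_nef m q (C N : nat) : nef_tuple (X := X) m ->
  compatible (X := X) m -> nef_tuple (X := X) q ->
  (forall i l k, `|q l 0%R k - q i 0%R k|%N <= C)%N -> (s * C <= N)%N ->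
  (forall a b, lattice_edge (divisor_polytope (X := X) m) a b ->
    (N <= lattice_length a b)%N) ->
  (forall i l b, fullc i -> fullc l -> wall i l b -> q i != q l -> m i != m l) ->
  nef_tuple (X := X) (fun i => m i - q i *+ s).
Proof.
move=> mN mC qN qC sCN mE strict; apply: local_global => // [i l x fi fl xi xl|].
  rewrite !ofZB !ofZMn !dotpE (mC i l x xi xl).
  have := nef_tuple_perp qN fi fl xi xl; rewrite ofZB !dotpE.
  by move/eqP; rewrite subr_eq0 => /eqP->.
move=> i l w u b e e' fi fl W wi wl e0 e'0 iu lu.
pose D := ofZ R (m l - m i); pose Q := ofZ R (q l - q i).
have Dperp := nef_tuple_perp mN fi fl; have Qperp := nef_tuple_perp qN fi fl.
have Du : dotp D (ofZ R u) <= 0.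
  have := nef_tuple_ge0 mN fi fl iu; rewrite -/D dotpBr dotpZr Dperp // sub0r.
  by rewrite oppr_ge0 pmulr_rle0.
have -> : ofZ R (m l - q l *+ s - (m i - q i *+ s)) = D - s%:R *: Q.
  by rewrite /D /Q !ofZB !ofZMn; apply/rowP => k; rewrite !mxE; ring.
have [qil|qil] := eqVneq (q i) (q l).
  by rewrite /Q qil subrr ofZ0 scaler0 subr0.
have mil := strict i l b fi fl W qil.
have D0 : D != 0 by exact: ofZ_sub_neq0.
have QE := wall_collinear W Dperp Qperp D0.
set la := _ / _ in QE.
have NE := mE _ _ (wall_edge mN mC fi fl W mil).
have [k Dk] : exists k, m l 0 k - m i 0 k != 0.
  apply: contrapT => h; case/eqP: mil; apply/rowP => k; apply/eqP.
  by rewrite eq_sym -subr_eq0; apply: contrapT => /negP hk; apply: h; exists k.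
have ND : (N <= `|m l 0%R k - m i 0%R k|)%N.
  apply: leq_trans NE _; apply: dvdn_leq; first by rewrite absz_gt0.
  by rewrite /lattice_length (bigD1 k) //= dvdn_gcdl.
have C0 : (0 < C)%N.
  rewrite lt0n; apply: contra_neq qil => C0; apply/rowP => z.
  by have := qC i l z; rewrite C0 leqn0 absz_eq0 subr_eq0 => /eqP.
have las : `|la| * s%:R <= 1.
  have : `|Q 0 k| = `|la| * `|D 0 k| by rewrite /Q QE mxE normrM.
  rewrite !mxE -!intr_norm -!abszE -!pmulrn => QD.
  have : `|la| * (s * C)%:R <= C%:R.
    apply: le_trans (_ : `|la| * `|m l 0%R k - m i 0%R k|%N%:R <= _).
      by rewrite ler_wpM2l // ler_nat (leq_trans sCN).
    by rewrite -QD ler_nat.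
  by rewrite natrM mulrA ger_pMl ?ltr0n.
rewrite /Q QE scalerA dotpBl dotpZl.
have : - 1 <= s%:R * la <= 1 by rewrite -ler_norml normrM normr_nat mulrC.
case/andP=> _ h; have := ler_wnM2r Du h; lra.
Qed.
End Edges.
(** * Laurent polynomials inside the function field *)

Section Laurent.
Variables (k : closedFieldType) (n : nat).
Implicit Types (a b m : 'rV[int]_n) (r : seq (k * 'rV[int]_n)).
Local Notation K := (funK k n).

Lemma constK0 : constK n (0 : k) = 0.
Proof. by rewrite /constK mpolyC0 tofrac0. Qed.

Lemma constK1 : constK n (1 : k) = 1.
Proof. by rewrite /constK mpolyC1 tofrac1. Qed.

Lemma constKD (c d : k) : constK n (c + d) = constK n c + constK n d.
Proof. by rewrite /constK mpolyCD tofracD. Qed.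

Lemma constKN (c : k) : constK n (- c) = - constK n c.
Proof. by apply/eqP; rewrite -addr_eq0 -constKD addNr constK0. Qed.

Lemma constKM (c d : k) : constK n (c * d) = constK n c * constK n d.
Proof. by rewrite /constK mpolyCM tofracM. Qed.

Lemma constK_eq0 (c : k) : (constK n c == 0) = (c == 0).
Proof. by rewrite /constK tofrac_eq0 mpolyC_eq0. Qed.

Lemma constKV (c : k) : constK n c^-1 = (constK n c)^-1.
Proof.
have [->|c0] := eqVneq c 0; first by rewrite invr0 constK0 invr0.
by apply: (mulIf (x := constK n c)); rewrite ?constK_eq0 // -constKM !mulVf
  ?constK_eq0 // constK1.
Qed.

Lemma constKX (c : k) d : constK n (c ^+ d) = constK n c ^+ d.
Proof. by elim: d => [|d IH]; rewrite ?constK1 // !exprS constKM IH. Qed.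

Let X_neq0 (i : 'I_n) : (tofrac ('X_i : {mpoly k[n]}) : K) != 0.
Proof.
rewrite tofrac_eq0; apply/eqP => /(congr1 (mcoeff U_(i)%MM)).
by rewrite mcoeffX eqxx mcoeff0 => /eqP; rewrite oner_eq0.
Qed.

Lemma chi0 : chi k (0 : 'rV[int]_n) = 1.
Proof. by rewrite /chi big1 // => i _; rewrite mxE expr0z. Qed.

Lemma chiD a b : chi k (a + b) = chi k a * chi k b.
Proof.
by rewrite /chi -big_split; apply: eq_bigr => i _; rewrite mxE expfzDr.
Qed.

Lemma chi_neq0 a : chi k a != 0.
Proof. by apply/prodf_neq0 => i _; rewrite expfz_neq0. Qed.

Lemma chiN a : chi k (- a) = (chi k a)^-1.
Proof.
by apply: (mulIf (chi_neq0 a)); rewrite -chiD addNr chi0 mulVf ?chi_neq0.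
Qed.

Lemma chiMn a d : chi k (a *+ d) = chi k a ^+ d.
Proof. by elim: d => [|d IH]; rewrite ?chi0 // mulrS chiD IH exprS. Qed.

Definition lsum r : K := \sum_(t <- r) constK n t.1 * chi k t.2.

Definition coef r m : k := \sum_(t <- r | t.2 == m) t.1.

Lemma lsum_cat r r' : lsum (r ++ r') = lsum r + lsum r'.
Proof. exact: big_cat. Qed.

Definition lmul r r' := [seq (t.1 * t'.1, t.2 + t'.2) | t <- r, t' <- r'].

Lemma lsum_mul r r' : lsum (lmul r r') = lsum r * lsum r'.
Proof.
rewrite /lsum big_allpairs_dep /= big_distrlr; apply: eq_bigr => t _ /=.
by apply: eq_bigr => t' _; rewrite constKM chiD mulrACA.
Qed.

Lemma lsum_single (c : k) m : lsum [:: (c, m)] = constK n c * chi k m.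
Proof. exact: big_seq1. Qed.

Lemma lsum_shift r (c : k) m :
  lsum [seq (t.1 * c, t.2 + m) | t <- r] = lsum r * (constK n c * chi k m).
Proof.
rewrite /lsum big_map mulr_suml; apply: eq_bigr => t _ /=.
by rewrite constKM chiD mulrACA.
Qed.

(** A common shift makes all exponents nonnegative, and then distinct exponents
    give distinct monomials of the polynomial ring. *)
Lemma lsum_eq0 r m : lsum r = 0 -> coef r m = 0.
Proof.
move=> r0; pose M := (\sum_(t <- (0%R, m) :: r) \sum_(i < n) `|t.2 0%R i|)%N.
have leM t i : t \in (0, m) :: r -> 0 <= t.2 0 i + M%:Z.
  move=> tr; have : (`|t.2 0%R i| <= M)%N.
    rewrite /M (big_rem t tr) /= (bigD1 i) //=.
    exact: leq_trans (leq_addr _ _) (leq_addr _ _).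
  by move: (t.2 0 i) => z; lia.
pose mon a := [multinom `|(a 0%R i + M%:Z)%R|%N | i < n].
have chi_mon t : t \in (0, m) :: r ->
    chi k (t.2 + const_mx M%:Z) = tofrac ('X_[mon t.2] : {mpoly k[n]}) :> K.
  move=> tr; rewrite mpolyXE_id rmorph_prod; apply: eq_bigr => i _.
  by rewrite rmorphXn /= !mxE mnmE exprnP gez0_abs ?leM.
have P0 : \sum_(t <- r) t.1 *: 'X_[mon t.2] = 0 :> {mpoly k[n]}.
  apply/eqP; rewrite -tofrac_eq0 rmorph_sum; apply/eqP.
  transitivity (lsum r * chi k (const_mx M%:Z)); last by rewrite r0 mul0r.
  rewrite mulr_suml big_seq [RHS]big_seq; apply: eq_bigr => t tr.
  by rewrite -mulrA -chiD chi_mon ?inE ?tr ?orbT // -mul_mpolyC rmorphM.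
have := congr1 (mcoeff (mon m)) P0; rewrite mcoeff0 raddf_sum /= => <-.
rewrite /coef big_mkcond big_seq [RHS]big_seq; apply: eq_bigr => t tr.
rewrite mcoeffZ mcoeffX; have [->|tm] := eqVneq t.2 m; first by rewrite eqxx mulr1.
case: eqP => [e|_]; last by rewrite mulr0.
case/eqP: tm; apply/rowP => i; have := congr1 (fun f : 'X_{1.. n} => f i) e.
rewrite !mnmE; have := leM t i; rewrite inE tr orbT => /(_ isT).
have := leM (0, m) i; rewrite inE eqxx => /(_ isT) /=.
by move: (t.2 0 i) (m 0 i) => x y; lia.
Qed.

Let partition_exponents (V : zmodType) r (S : seq 'rV[int]_n) (F : k * 'rV[int]_n -> V) :
  uniq S -> {subset map snd r <= S} ->
  \sum_(t <- r) F t = \sum_(m <- S) \sum_(t <- r | t.2 == m) F t.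
Proof.
move=> uS rS; rewrite (exchange_big_dep xpredT) //= big_seq [RHS]big_seq.
apply: eq_bigr => t tr; rewrite -big_filter.
rewrite (_ : [seq m <- S | _] = [:: t.2]) ?big_seq1 //.
have tS : t.2 \in S by apply/rS/map_f.
rewrite -(filter_pred1_uniq uS tS); apply: eq_filter => m.
by rewrite /= eq_sym.
Qed.

(** By independence of the characters, any function on the exponents extends to
    an additive function on Laurent polynomials. *)
Lemma lsum_eval (F : fieldType) (iota : {rmorphism k -> F}) (f : 'rV[int]_n -> F) r r' :
  lsum r = lsum r' ->
  \sum_(t <- r) iota t.1 * f t.2 = \sum_(t <- r') iota t.1 * f t.2.
Proof.
move=> rr'; pose q := r ++ [seq (- t.1, t.2) | t <- r'].
have q0 : lsum q = 0.
  rewrite lsum_cat rr'; apply/eqP; rewrite addrC addr_eq0; apply/eqP.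
  rewrite /lsum big_map -sumrN; apply: eq_bigr => t _ /=.
  by rewrite constKN mulNr.
suff : \sum_(t <- q) iota t.1 * f t.2 = 0.
  rewrite big_cat big_map /= => /eqP; rewrite addr_eq0 => /eqP->.
  by rewrite -sumrN; apply: eq_bigr => t _; rewrite rmorphN mulNr opprK.
rewrite (@partition_exponents _ q (undup (map snd q))) ?undup_uniq //; last first.
  by move=> m; rewrite mem_undup.
rewrite big1 // => m _; transitivity (iota (coef q m) * f m).
  by rewrite /coef rmorph_sum mulr_suml; apply: eq_bigr => t /eqP->.
by rewrite lsum_eq0 // rmorph0 mul0r.
Qed.

Lemma lsum_coef r r' m : lsum r = lsum r' -> coef r m = coef r' m.
Proof.
move=> rr'; have := @lsum_eval k idfun (fun a => (a == m)%:R) _ _ rr'.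
have E q : \sum_(t <- q) t.1 * (t.2 == m)%:R = coef q m.
  rewrite /coef [RHS]big_mkcond; apply: eq_bigr => t _.
  by case: eqP; rewrite (mulr1, mulr0).
by rewrite !E.
Qed.

Lemma coef_neq0 r m : coef r m != 0 -> m \in map snd r.
Proof.
apply: contraNT => mr; rewrite /coef big_seq_cond big1 // => t /andP[tr /eqP tm].
by case/negP: mr; rewrite -tm map_f.
Qed.

Definition reduced r :=
  [/\ uniq r, {in r &, injective snd} & forall t, t \in r -> t.1 != 0].

Lemma lsum_reduced r : exists2 r', reduced r' & lsum r' = lsum r.
Proof.
pose S := [seq m <- undup (map snd r) | coef r m != 0].
exists [seq (coef r m, m) | m <- S].
  split.
  - by rewrite map_inj_uniq ?filter_uniq ?undup_uniq // => m m' [].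
  - by move=> t t' /mapP[m _ ->] /mapP[m' _ ->] /= ->.
  - by move=> t /mapP[m]; rewrite mem_filter => /andP[cm _] ->.
rewrite /lsum big_map /= (@partition_exponents _ r (undup (map snd r))) ?undup_uniq //.
  rewrite big_filter big_mkcond; apply: eq_bigr => m _.
  have E : \sum_(t <- r | t.2 == m) constK n t.1 * chi k t.2 =
      constK n (coef r m) * chi k m.
    rewrite /coef (big_morph _ constKD constK0) mulr_suml.
    by apply: eq_bigr => t /eqP->.
  by rewrite E; case: eqP => //= ->; rewrite constK0 mul0r.
by move=> m; rewrite mem_undup.
Qed.

Lemma coef_reduced r t : reduced r -> t \in r -> coef r t.2 = t.1.
Proof.
move=> [ur ir _] tr; rewrite /coef big_mkcond (bigD1_seq t) //= eqxx.
rewrite big_seq_cond big1 ?addr0 // => t' /andP[t'r t't]; case: eqP => // e.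
by case/eqP: t't; apply: ir.
Qed.

(** The only pair of exponents with the sum [t.2 + t'.2] is the maximal one. *)
Let coef_mul_extreme r r' t t' (v : 'rV[int]_n -> rat) :
  reduced r -> reduced r' -> (forall a b, v (a + b) = v a + v b) ->
  {in r &, injective (v \o snd)} -> {in r' &, injective (v \o snd)} ->
  t \in r -> t' \in r' -> (forall x, x \in r -> v x.2 <= v t.2) ->
  (forall x, x \in r' -> v x.2 <= v t'.2) ->
  coef (lmul r r') (t.2 + t'.2) = t.1 * t'.1.
Proof.
move=> [ur ir _] [ur' ir' _] vD vr vr' tr t'r' tmax t'max.
rewrite /coef big_mkcond big_allpairs_dep /= (bigD1_seq t) //= [X in _ + X]big_seq_cond.
rewrite (bigD1_seq t') //= eqxx [X in _ + X + _]big_seq_cond big1 => [|y /andP[yr' yt']].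
  rewrite addr0 big1 ?addr0 // => x /andP[xr xt]; rewrite big_seq big1 // => y yr'.
  case: eqP => // e; case/eqP: xt; apply: vr => //=; apply: le_anti.
  rewrite tmax //= -(lerD2r (v t'.2)) -vD -e vD lerD2l; exact: t'max.
by case: eqP => // /addrI e; case/eqP: yt'; apply: ir'.
Qed.

(** The exponents of two inverse Laurent polynomials that maximize a linear
    form injective on them add up to zero, as their product cannot cancel; the
    minima do so as well, so the maximum and the minimum agree. *)
Lemma unit_monomial r r' : lsum r * lsum r' = 1 ->
  exists c m, c != 0 /\ lsum r = constK n c * chi k m.
Proof.
have [r1 red1 <-] := lsum_reduced r; have [r2 red2 <-] := lsum_reduced r'.
move=> {r r'} r12.
pose G := [seq delta_mx 0 i : 'rV[rat]_n | i <- enum 'I_n].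
pose Q a : 'rV[rat]_n := map_mx intr a.
have QD a b : Q (a + b) = Q a + Q b by apply/rowP => i; rewrite !mxE intrD.
pose diffs r := [seq Q (x.2 - y.2) | x <- r, y <- r].
pose ps := [seq p <- diffs r1 ++ diffs r2 | p != 0].
have [p|s [_ hs]] := @generic_comb rat n G ps.
  rewrite mem_filter => /andP[p0 _].
  have [i pi] : exists i, p 0 i != 0.
    apply: contrapT => h; case/eqP: p0; apply/rowP => i; rewrite mxE; apply/eqP.
    by apply: contrapT => /negP pi; apply: h; exists i.
  by exists (delta_mx 0 i); rewrite ?dotp_delta // map_f // mem_enum.
set w := \sum_(_ < _) _ in hs.
pose v a := dotp (Q a) w.
have vD a b : v (a + b) = v a + v b by rewrite /v QD dotpDl.
have v0 : v 0 = 0 by apply: (addrI (v 0)); rewrite -vD !addr0.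
have vN a : v (- a) = - v a by apply: (addrI (v a)); rewrite -vD !subrr.
have vinj q : {subset diffs q <= diffs r1 ++ diffs r2} ->
    {in q &, injective snd} -> {in q &, injective (v \o snd)}.
  move=> dq iq x y xq yq /= vxy; apply: iq => //.
  apply/eqP; rewrite -subr_eq0; apply: contrapT => /negP d0.
  have /hs/eqP[] : Q (x.2 - y.2) \in ps.
    rewrite mem_filter dq ?andbT; last by apply/allpairsP; exists (x, y).
    apply: contraNneq d0 => /rowP q0; apply/eqP/rowP => i; have := q0 i.
    by rewrite !mxE => /eqP; rewrite intr_eq0 => /eqP.
  by rewrite -/(v _) vD vN vxy subrr.
have v1 : {in r1 &, injective (v \o snd)}.
  by apply: vinj; [move=> p pd; rewrite mem_cat pd|case: red1].
have v2 : {in r2 &, injective (v \o snd)}.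
  by apply: vinj; [move=> p pd; rewrite mem_cat pd orbT|case: red2].
have nonempty q q' : lsum q * lsum q' = 1 -> exists t, t \in q.
  case: q => [|t q]; last by exists t; rewrite inE eqxx.
  by rewrite /lsum big_nil mul0r => /eqP; rewrite eq_sym oner_eq0.
have maxi (q : seq (k * 'rV[int]_n)) (f : 'rV[int]_n -> rat) :
    (exists t : k * 'rV[int]_n, t \in q) ->
    exists2 t, t \in q & forall x, x \in q -> f x.2 <= f t.2.
  elim: q => [[z] //|t q IH _]; have [/eqP q0|q0] := boolP (q == [::]).
    by exists t; rewrite ?inE ?eqxx // q0 => x; rewrite inE => /eqP->.
  have [|y yq ymax] := IH.
    by case: (q) q0 => // y q' _; exists y; rewrite inE eqxx.
  have [ty|yt] := leP (f t.2) (f y.2).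
    by exists y; [rewrite inE yq orbT|move=> x; rewrite inE => /orP[/eqP->|/ymax]].
  exists t; first by rewrite inE eqxx.
  move=> x; rewrite inE => /orP[/eqP-> //|/ymax h].
  exact: le_trans h (ltW yt).
have extreme (f : 'rV[int]_n -> rat) : (forall a b, f (a + b) = f a + f b) ->
    {in r1 &, injective (f \o snd)} -> {in r2 &, injective (f \o snd)} ->
    exists t t', [/\ t \in r1, forall x, x \in r1 -> f x.2 <= f t.2, t' \in r2,
      forall x, x \in r2 -> f x.2 <= f t'.2 & t.2 + t'.2 = 0].
  move=> fD f1 f2.
  have [t tr tm] := maxi r1 f (nonempty _ _ r12).
  have [|t' tr' tm'] := maxi r2 f; first by apply: (nonempty r2 r1); rewrite mulrC.
  exists t, t'; split=> //; apply/eqP.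
  have [_ _ /(_ t tr) t10] := red1; have [_ _ /(_ t' tr') t'10] := red2.
  have := mulf_neq0 t10 t'10.
  rewrite -(coef_mul_extreme red1 red2 fD f1 f2 tr tr' tm tm').
  rewrite (@lsum_coef _ [:: (1, 0)]); last first.
    by rewrite lsum_mul r12 lsum_single constK1 chi0 mulr1.
  by move/coef_neq0; rewrite inE.
have [t [t' [tr tm tr' tm' tt']]] := extreme v vD v1 v2.
have [|||u [u' [ur um ur' um' uu']]] := extreme (fun a => - v a).
- by move=> a b; rewrite vD opprD.
- by move=> x y xr yr /= /oppr_inj; exact: v1.
- by move=> x y xr yr /= /oppr_inj; exact: v2.
have same x : x \in r1 -> x.2 = t.2.
  move=> xr; congr snd; apply: v1 => //=; apply: le_anti; rewrite tm //=.
  have := um x xr; have := tm' u' ur'; have := congr1 v tt'; have := congr1 v uu'.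
  by rewrite !vD v0; lra.
exists (\sum_(x <- r1) x.1), t.2.
have E : lsum r1 = constK n (\sum_(x <- r1) x.1) * chi k t.2.
  rewrite (big_morph _ constKD constK0) mulr_suml /lsum big_seq [RHS]big_seq.
  by apply: eq_bigr => x /same->.
split=> //; apply/eqP => c0; move: r12; rewrite E c0 constK0 !mul0r => /eqP.
by rewrite eq_sym oner_eq0.
Qed.

End Laurent.
(** * Points of toric charts *)

(** The lattice points of the dual cone, which span the ring [reg C]. *)
Definition dual_cone (R : realType) n (C : 'rV[R]_n -> Prop) (a : 'rV[int]_n) :=
  forall x, C x -> 0 <= dotp (ofZ R a) x.

Definition perp (R : realType) n (C : 'rV[R]_n -> Prop) (a : 'rV[int]_n) :=
  forall x, C x -> dotp (ofZ R a) x = 0.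

Section Regular.
Variables (R : realType) (k : closedFieldType) (n : nat).
Implicit Types (C : 'rV[R]_n -> Prop) (a b : 'rV[int]_n) (f g : funK k n).

Lemma dual_cone0 C : dual_cone C 0.
Proof. by move=> x _; rewrite ofZ0 dotp0l. Qed.

Lemma perp_dual C a : perp C a -> dual_cone C a.
Proof. by move=> pa x /pa->. Qed.

Lemma perpN C a : perp C a -> perp C (- a).
Proof. by move=> pa x /pa h; rewrite ofZN dotpNl h oppr0. Qed.

Lemma reg_monomial C (c : k) a : dual_cone C a -> reg C (constK n c * chi k a).
Proof.
move=> da; exists [:: (c, a)]; last by rewrite big_seq1.
by move=> t; rewrite inE => /eqP->.
Qed.

Lemma reg_chi C a : dual_cone C a -> reg C (chi k a).
Proof. by move=> da; have := @reg_monomial C (1 : k) a da; rewrite constK1 mul1r. Qed.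

Lemma reg_const C (c : k) : reg C (constK n c).
Proof. by have := @reg_monomial C c 0 (@dual_cone0 C); rewrite chi0 mulr1. Qed.

Lemma reg_dual C (r : seq (k * 'rV[int]_n)) a :
  reg C (lsum r) -> coef r a != 0 -> dual_cone C a.
Proof.
move=> [r' dr' rr'] ca; have : coef r' a != 0 by rewrite -(@lsum_coef _ _ r).
by move/coef_neq0 => /mapP[t tr ->] x /(dr' t tr).
Qed.

Lemma reg_monomialP C (c : k) a : c != 0 -> reg C (constK n c * chi k a) ->
  dual_cone C a.
Proof.
move=> c0; rewrite -lsum_single => /reg_dual; apply.
by rewrite /coef big_mkcond big_seq1 eqxx.
Qed.

Section Evaluation.
Variables (F : fieldType) (iota : {rmorphism k -> F}).

(** The additive extension of a function on the characters, with the default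
    value 0 outside the Laurent polynomials. *)
Definition evalK (phi : 'rV[int]_n -> F) f : F :=
  if pselect (exists r, f = lsum r) is left h
  then \sum_(t <- sval (cid h)) iota t.1 * phi t.2 else 0.

Lemma evalK_lsum phi r : evalK phi (lsum r) = \sum_(t <- r) iota t.1 * phi t.2.
Proof.
rewrite /evalK; case: pselect => [h|[]]; last by exists r.
by case: (cid h) => r' /= rr'; apply: lsum_eval.
Qed.

Lemma evalK_monomial phi c a : evalK phi (constK n c * chi k a) = iota c * phi a.
Proof. by rewrite -lsum_single evalK_lsum big_seq1. Qed.

Lemma evalK_chi phi a : evalK phi (chi k a) = phi a.
Proof. by rewrite -[chi k a]mul1r -constK1 evalK_monomial rmorph1 mul1r. Qed.

Lemma evalK_point C phi : phi 0 = 1 ->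
  (forall a b, dual_cone C a -> dual_cone C b -> phi (a + b) = phi a * phi b) ->
  is_point (reg C) iota (evalK phi).
Proof.
move=> phi0 phiM; split=> [c|f g [r dr ->] [r' dr' ->]].
  by rewrite -[constK n c]mulr1 -(chi0 k n) evalK_monomial phi0 mulr1.
rewrite -/(lsum r) -/(lsum r') -lsum_cat -lsum_mul !evalK_lsum big_cat; split=> //.
rewrite big_allpairs_dep /= big_distrlr /= big_seq [RHS]big_seq.
apply: eq_bigr => t tr; rewrite big_seq [RHS]big_seq; apply: eq_bigr => t' tr'.
by rewrite phiM; [rewrite rmorphM mulrACA|exact: dr|exact: dr'].
Qed.

(** The point [c ^ u] of the torus, acting on the distinguished point of the
    orbit of [C]. *)
Definition orbit_char C (u : 'rV[int]_n) (c : F) a : F :=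
  if `[< perp C a >] then c ^ dotp a u else 0.

Lemma orbit_char_perp C u c a : perp C a -> orbit_char C u c a = c ^ dotp a u.
Proof. by rewrite /orbit_char => /asboolP->. Qed.

Lemma orbit_char_nperp C u c a : ~ perp C a -> orbit_char C u c a = 0.
Proof. by rewrite /orbit_char; case: asboolP. Qed.

Lemma orbit_point C u c : c != 0 ->
  is_point (reg C) iota (evalK (orbit_char C u c)).
Proof.
move=> c0; have perp0 : perp C 0 by move=> x _; rewrite ofZ0 dotp0l.
apply: evalK_point => [|a b da db].
  by rewrite orbit_char_perp // dotp0l expr0z.
have [pa|npa] := pselect (perp C a); last first.
  rewrite (orbit_char_nperp _ _ npa) mul0r orbit_char_nperp // => pab; apply: npa.
  move=> x Cx; apply/eqP; rewrite eq_le da // andbT.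
  by have := pab x Cx; rewrite ofZD dotpDl => <-; rewrite lerDl db.
have [pb|npb] := pselect (perp C b); last first.
  rewrite (orbit_char_nperp _ _ npb) mulr0 orbit_char_nperp // => pab; apply: npb.
  by move=> x Cx; have := pab x Cx; rewrite ofZD dotpDl pa // add0r.
rewrite !orbit_char_perp // ?dotpDl ?expfzDr // => x Cx.
by rewrite ofZD dotpDl pa // pb // addr0.
Qed.

Lemma point_monomial C y c a : is_point (reg C) iota y -> dual_cone C a ->
  y (constK n c * chi k a) = iota c * y (chi k a).
Proof.
move=> [yc yM] da; rewrite -yc.
by have [] := yM _ _ (@reg_const C c) (reg_chi da).
Qed.

Lemma point_chi_neq0 C y a : is_point (reg C) iota y -> perp C a -> y (chi k a) != 0.
Proof.
move=> [yc yM] pa.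
have [_] := yM _ _ (reg_chi (perp_dual pa)) (reg_chi (perp_dual (perpN pa))).
rewrite -chiD subrr chi0 -constK1 yc rmorph1 => e.
by apply: contra_eq_neq e => ->; rewrite mul0r oner_eq0.
Qed.

End Evaluation.
End Regular.

(** * Line bundles and their sections *)

(** Identities between local equations [g * (c * x)], with a rational function
    [g], a constant [c] and a character [x]. *)
Section FieldIdentities.
Variable F : fieldType.
Implicit Types a b c d f g x y : F.

Lemma mul_unit_div c g x : g != 0 -> x != 0 -> g * (c * x) / (g * x) = c.
Proof. by move=> g0 x0; field; rewrite ?g0 ?x0. Qed.

Lemma div_mul_unit c g x : c != 0 -> g != 0 -> x != 0 ->
  g * x / (g * (c * x)) = c^-1.
Proof. by move=> c0 g0 x0; field; rewrite ?c0 ?g0 ?x0. Qed.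

Lemma div_mul_div a b : a != 0 -> b != 0 -> a / b * (b / a) = 1.
Proof. by move=> a0 b0; field; rewrite ?a0 ?b0. Qed.

Lemma transition a b g x y : g != 0 -> b != 0 -> x != 0 -> y != 0 ->
  g * (a * x^-1) / (g * (b * y^-1)) = a / b * (y * x^-1).
Proof. by move=> g0 b0 x0 y0; field; rewrite ?g0 ?b0 ?x0 ?y0. Qed.

Lemma untwist f g c x : c != 0 -> x != 0 ->
  f * g = f * (g * (c * x^-1)) * (c^-1 * x).
Proof. by move=> c0 x0; field; rewrite ?c0 ?x0. Qed.

Lemma mul_trivializations g1 c1 x1 g2 c2 x2 :
  (g1 * (c1 * x1)) * (g2 * (c2 * x2)) = g1 * g2 * (c1 * c2 * (x1 * x2)).
Proof. by ring. Qed.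

Lemma twist d x g c y : g != 0 ->
  d * x / g * (g * (c * y)) = d * c * (x * y).
Proof. by move=> g0; field. Qed.

End FieldIdentities.

Section Bundles.
Variables (R : realType) (k : closedFieldType) (n : nat) (X : fan R n).
Local Notation s := (fan_size X).
Local Notation cone := (@fan_cone R n X).
Local Notation gens := (@fan_gens R n X).
Implicit Types (i j l : 'I_s) (m : 'I_s -> 'rV[int]_n) (L : local_equations k X).

Definition toric_form L (g : funK k n) (c : 'I_s -> k) m :=
  [/\ g != 0, forall i, c i != 0 & forall i, L i = g * (constK n (c i) * chi k (- m i))].

Lemma toric_form_tensor L1 L2 g1 g2 c1 c2 m1 m2 :
  toric_form L1 g1 c1 m1 -> toric_form L2 g2 c2 m2 ->
  toric_form (tensor L1 L2) (g1 * g2) (fun i => c1 i * c2 i) (fun i => m1 i + m2 i).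
Proof.
move=> [g10 c10 E1] [g20 c20 E2]; split=> [|i|i].
- exact: (mulf_neq0 g10 g20).
- exact: (mulf_neq0 (c10 i) (c20 i)).
- by rewrite /tensor E1 E2 mul_trivializations opprD chiD constKM.
Qed.

Lemma toric_form_pow L g c m d : toric_form L g c m ->
  toric_form (tensor_pow L d) (g ^+ d) (fun i => c i ^+ d) (fun i => m i *+ d).
Proof.
move=> [g0 c0 E]; split=> [|i|i].
- by rewrite expf_neq0 ?g0.
- by rewrite expf_neq0 ?c0.
- by rewrite /tensor_pow E !exprMn constKX -mulNrn chiMn.
Qed.

Lemma toric_form_isom L g c m : toric_form L g c m -> isom L (toric_bundle k m).
Proof.
move=> [g0 c0 E]; exists g => // i; rewrite E /toric_bundle.
have h0 := chi_neq0 k (- m i); have h1 : constK n (c i) != 0 by rewrite constK_eq0.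
have x0 := chi_neq0 k (- m i).
have ci0 : constK n (c i) != 0 by rewrite constK_eq0 c0.
rewrite (mul_unit_div _ g0 x0) (div_mul_unit ci0 g0 x0) -constKV.
by split; exact: reg_const.
Qed.

(** The ratio of two local equations is an invertible Laurent polynomial, hence a
    monomial.  It is regular on the overlap together with its inverse, so its
    exponent vanishes on the intersection of the cones. *)
Lemma line_bundle_toric L : 'I_s -> line_bundle L ->
  exists g c m, toric_form L g c m /\ compatible m.
Proof.
move=> i0 [L0 LL].
have : forall i, exists ca : k * 'rV[int]_n,
    ca.1 != 0 /\ L i / L i0 = constK n ca.1 * chi k ca.2.
  move=> i; have [r _ rE] := LL i i0; have [r' _ r'E] := LL i0 i.
  have [|c [a [c0 E]]] := @unit_monomial k n r r'.
    by rewrite -[lsum r]rE -[lsum r']r'E (div_mul_div (L0 i) (L0 i0)).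
  by exists (c, a); split=> //; rewrite rE.
move=> /choice[ca hca].
have [c [m LE]] : exists c m, toric_form L (L i0) c m.
  exists (fun i => (ca i).1), (fun i => - (ca i).2).
  split=> [|i|i]; [exact: L0|by have [] := hca i|].
  have [_ E] := hca i; rewrite opprK -E.
  by rewrite [RHS]mulrC (divfK (L0 i0)).
exists (L i0), c, m; split=> // i j x xi xj.
have [_ c0 E] := LE.
have dual i' j' : dual_cone (cap (cone i') (cone j')) (m j' - m i').
  apply: (@reg_monomialP R k n _ (c i' / c j')); first by rewrite mulf_neq0 ?invr_eq0 ?c0.
  have <- : L i' / L j' = constK n (c i' / c j') * chi k (m j' - m i').
    rewrite (E i') (E j') chiD constKM constKV !chiN.
    apply: transition (L0 i0) _ (chi_neq0 k _) (chi_neq0 k _).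
    by rewrite constK_eq0 c0.
  exact: LL.
apply: le_anti; have := dual i j x (conj xi xj); have := dual j i x (conj xj xi).
by rewrite !ofZB !dotpBl !subr_ge0 => -> ->.
Qed.

(** The exponents of a section lie in the polytope: on each chart they are among
    the exponents of a regular function. *)
Lemma H0_toric L g c m f : 'I_s -> toric_form L g c m -> H0 L f ->
  exists r, [/\ reduced r, f * g = lsum r &
    forall t, t \in r -> forall i, dual_cone (cone i) (t.2 - m i)].
Proof.
move=> i0 [g0 c0 E] Hf.
have fgE i : f * g = f * L i * (constK n (c i)^-1 * chi k (m i)).
  have ci0 : constK n (c i) != 0 by rewrite constK_eq0 c0.
  by rewrite E chiN constKV -(untwist _ _ ci0 (chi_neq0 k (m i))).
have rep i : exists2 q, f * g = lsum q &
    forall t, t \in q -> dual_cone (cone i) (t.2 - m i).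
  have [q dq qE] := Hf i; exists [seq (t.1 * (c i)^-1, t.2 + m i) | t <- q].
    by rewrite lsum_shift (fgE i) qE.
  by move=> t /mapP[t' /dq dt' ->] /=; rewrite addrK => x /dt'.
have [q0 qE _] := rep i0; have [r red rq] := lsum_reduced q0.
exists r; split=> // [|t tr i]; first by rewrite qE.
have [q qE' dq] := rep i.
have : coef q t.2 != 0.
  rewrite -(@lsum_coef _ _ r); last by rewrite rq -qE.
  by rewrite coef_reduced //; have [_ _] := red; apply.
by move/coef_neq0 => /mapP[t' /dq dt' ->].
Qed.

Lemma H0_monomial L g c m d p : toric_form L g c m ->
  (forall i, dual_cone (cone i) (p - m i)) -> H0 L (constK n d * chi k p / g).
Proof.
move=> [g0 c0 E] hp i; rewrite E /chart.
have -> : constK n d * chi k p / g * (g * (constK n (c i) * chi k (- m i))) =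
    constK n (d * c i) * chi k (p - m i).
  by rewrite constKM chiD (twist _ _ _ _ g0).
exact: reg_monomial.
Qed.

Hypothesis hX : complete_fan X.

Lemma in_polytope_dual m p : compatible m -> in_polytope m p ->
  forall i, dual_cone (cone i) (p - m i).
Proof.
move=> mC mp i x xi; have [l fl xl] := full_cover hX x.
rewrite ofZB dotpBl (mC i l x xi xl) -dotpBl -ofZB.
apply: (convex_dual (i := l)) => // g gG; rewrite dotp_ofZ ler0z; exact: mp.
Qed.

Lemma dual_in_polytope m p : (forall i, dual_cone (cone i) (p - m i)) ->
  in_polytope m p.
Proof.
move=> h i _ g gG; rewrite -(ler0z R) -dotp_ofZ; apply: h; exact: hull_gen.
Qed.

End Bundles.
(** * The places of the rational function field *)

Section PlaceTheory.
Variables (k : closedFieldType) (F : fieldType) (iota : {rmorphism k -> F}).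
Variable w : F -> int.
Hypothesis wP : place iota w.
Implicit Types x y : F.

Lemma place_mul x y : x != 0 -> y != 0 -> w (x * y) = w x + w y.
Proof. by case: wP => _ h _ _ _; exact: h. Qed.

Lemma place_const c : c != 0 -> w (iota c) = 0.
Proof. by case: wP => _ _ _ h _; exact: h. Qed.

Lemma place0 : w 0 = 0. Proof. by case: wP. Qed.

Lemma place1 : w 1 = 0.
Proof. by rewrite -(rmorph1 iota) place_const ?oner_neq0. Qed.

Lemma place_inv x : x != 0 -> w x^-1 = - w x.
Proof.
move=> x0; apply: (addrI (w x)); rewrite -place_mul ?invr_eq0 //.
by rewrite divff // place1 subrr.
Qed.

Lemma place_opp x : w (- x) = w x.
Proof.
have [->|x0] := eqVneq x 0; first by rewrite oppr0.
rewrite -mulN1r place_mul ?oppr_eq0 ?oner_neq0 //.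
by rewrite -(rmorphN1 iota) place_const ?oppr_eq0 ?oner_neq0 // add0r.
Qed.

Lemma place_add_ge0 x y : 0 <= w x -> 0 <= w y -> 0 <= w (x + y).
Proof.
move=> wx wy; have [->|x0] := eqVneq x 0; first by rewrite add0r.
have [->|y0] := eqVneq y 0; first by rewrite addr0.
have [->|xy0] := eqVneq (x + y) 0; first by rewrite place0.
by case: wP => _ _ /(_ x y x0 y0 xy0) h _ _; apply: le_trans h; rewrite le_min wx.
Qed.

Lemma place_dominant x y : x != 0 -> y != 0 -> w x < w y ->
  w (x + y) = w x.
Proof.
move=> x0 y0 xy; have xy0 : x + y != 0.
  by apply: contraTneq xy => /eqP; rewrite addr_eq0 => /eqP->; rewrite place_opp ltxx.
have [_ _ wD _ _] := wP; apply: le_anti.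
have := wD _ _ x0 y0 xy0; rewrite (min_idPl (ltW xy)) => ->; rewrite andbT.
have := wD (x + y) (- y) xy0; rewrite oppr_eq0 addrK => /(_ y0 x0).
by rewrite place_opp ge_min leNgt [w y <= _]leNgt xy orbF -leNgt.
Qed.

Lemma place_exprz x (z : int) : x != 0 -> w (x ^ z) = z * w x.
Proof.
move=> x0; have pow d : w (x ^+ d) = d%:Z * w x.
  elim: d => [|d IH]; first by rewrite expr0 place1 mul0r.
  by rewrite exprS place_mul ?expf_neq0 // IH; lia.
case: z => d; first by rewrite -exprnP pow.
by rewrite NegzE -exprz_inv /= -exprnP exprVn place_inv ?expf_neq0 // pow; lia.
Qed.

End PlaceTheory.

Lemma fractionP (A : idomainType) (x : {fraction A}) :
  exists pq : A * A, pq.2 != 0 /\ x = tofrac pq.1 / tofrac pq.2.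
Proof.
elim/quotW: x => y; have d0 := fraction.denom_ratioP y.
exists (fraction.frac y); split=> //.
have dF : tofrac (fraction.frac y).2 != 0 by rewrite tofrac_eq0.
apply: (mulIf dF); rewrite divfK //.
change (FracField.mul (\pi_(FracField.type A)%qT y) (tofrac (fraction.frac y).2) =
  tofrac (fraction.frac y).1).
rewrite !piE; apply/eqmodP => /=.
rewrite FracField.equivfE /FracField.mulf !numden_Ratio ?oner_eq0 ?mulr1 //.
by rewrite mulrC.
Qed.

Section Places.
Variable k : closedFieldType.
Local Notation F := ({fraction {poly k}} : fieldType).
Implicit Types (p q : {poly k}) (x y : F).

Definition constF : {rmorphism k -> F} := @tofrac {poly k} \o polyC.
Definition paramF : F := tofrac ('X : {poly k}).

Lemma curve_function_field_ratfun : curve_function_field constF.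
Proof.
have ev p : (map_poly constF p).[paramF] = tofrac p.
  by rewrite map_poly_comp /= horner_map /= -[_.['X]]/(p \Po 'X) comp_polyXr.
exists paramF; split=> [p p0|]; first by rewrite ev tofrac_eq0.
exists 1%N, (fun=> 1) => f; have [[p q] /= [q0 ->]] := fractionP f.
exists q, (fun=> p); split=> //.
by rewrite !ev big_ord1 mulr1 mulrC divfK // tofrac_eq0.
Qed.


(** The valuation of the fractions that extends [mu]. *)
Section FractionValuation.
Variable mu : {poly k} -> int.
Hypothesis muM : forall p q, p != 0 -> q != 0 -> mu (p * q) = mu p + mu q.
Hypothesis muD : forall p q, p != 0 -> q != 0 -> p + q != 0 ->
  Num.min (mu p) (mu q) <= mu (p + q).
Hypothesis muC : forall c, c != 0 -> mu c%:P = 0.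
Hypothesis mu1 : exists p q, [/\ p != 0, q != 0 & mu p - mu q = 1].

Definition fracval x : int :=
  if x == 0 then 0 else
  let pq := sval (cid (fractionP x)) in mu pq.1 - mu pq.2.

Lemma fracvalE p q : p != 0 -> q != 0 ->
  fracval (tofrac p / tofrac q) = mu p - mu q.
Proof.
move=> p0 q0; rewrite /fracval mulf_eq0 invr_eq0 !tofrac_eq0 (negPf p0) (negPf q0) /=.
case: (cid (fractionP _)) => -[p' q'] /= [q'0 E].
have p'0 : p' != 0.
  apply: contraNneq p0 => p'0; move/eqP: E; rewrite p'0 tofrac0 mul0r.
  by rewrite mulf_eq0 invr_eq0 !tofrac_eq0 (negPf q0) orbF.
have : p * q' = p' * q.
  apply/eqP; rewrite -tofrac_eq !tofracM; apply/eqP.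
  have qF : tofrac q != 0 :> F by rewrite tofrac_eq0.
  have q'F : tofrac q' != 0 :> F by rewrite tofrac_eq0.
  by apply/eqP; rewrite -(eqr_div _ _ qF q'F) E.
move/(congr1 mu); rewrite !muM //.
move: (mu p) (mu q) (mu p') (mu q') => a b c d; lia.
Qed.

Lemma fracval_place : place constF fracval.
Proof.
have nz x : x != 0 -> exists p q, [/\ p != 0, q != 0 & x = tofrac p / tofrac q].
  move=> x0; have [[p q] /= [q0 E]] := fractionP x; exists p, q; split=> //.
  by apply: contraNneq x0 => p0; rewrite E p0 tofrac0 mul0r.
have toF p : p != 0 -> tofrac p != 0 :> F by rewrite tofrac_eq0.
split=> [|x y|x y|c c0|].
- by rewrite /fracval eqxx.
- move=> /nz[p [q [p0 q0 ->]]] /nz[p' [q' [p'0 q'0 ->]]].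
  rewrite mulf_div -!tofracM !fracvalE ?mulf_neq0 // !muM //.
  move: (mu p) (mu q) (mu p') (mu q') => a b c d; lia.
- move=> /nz[p [q [p0 q0 ->]]] /nz[p' [q' [p'0 q'0 ->]]] xy0.
  have E : tofrac p / tofrac q + tofrac p' / tofrac q' =
      tofrac (p * q' + p' * q) / tofrac (q * q') :> F.
    by rewrite addf_div ?toF // -!tofracM -tofracD.
  have n0 : p * q' + p' * q != 0.
    by apply: contraNneq xy0 => n0; rewrite E n0 tofrac0 mul0r.
  rewrite E !fracvalE ?mulf_neq0 // !muM //.
  have := muD (mulf_neq0 p0 q'0) (mulf_neq0 p'0 q0) n0; rewrite !muM //.
  rewrite !ge_min; move: (mu p) (mu q) (mu p') (mu q') (mu (_ + _)) => a b c d e.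
  by case/orP => h; apply/orP; [left|right]; lia.
- have -> : constF c = tofrac c%:P / tofrac 1 by rewrite tofrac1 divr1.
  by rewrite fracvalE ?polyC_eq0 ?oner_eq0 // muC // -[1]/(1%:P) muC ?oner_neq0.
have [p [q [p0 q0 pq]]] := mu1; exists (tofrac p / tofrac q).
  by rewrite mulf_neq0 ?invr_eq0 ?toF.
by rewrite fracvalE.
Qed.

(** The values of [w] are multiples of [e], so [e] is 1 as [w] is normalized. *)
Lemma place_fracval w e : place constF w -> 0 < e ->
  (forall p, p != 0 -> w (tofrac p) = mu p * e) -> fracval =1 w.
Proof.
move=> wP e0 wE.
have wF x : w x = fracval x * e.
  have [->|x0] := eqVneq x 0; first by rewrite (place0 wP) /fracval eqxx mul0r.
  have [[p q] /= [q0 E]] := fractionP x.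
  have p0 : p != 0 by apply: contraNneq x0 => p0; rewrite E p0 tofrac0 mul0r.
  have pF : tofrac p != 0 :> F by rewrite tofrac_eq0.
  have qF : tofrac q != 0 :> F by rewrite tofrac_eq0.
  rewrite E (place_mul wP pF) ?invr_eq0 // (place_inv wP qF).
  by rewrite !wE // fracvalE // mulrBl.
suff e1 : e = 1 by move=> x; rewrite wF e1 mulr1.
case: wP => _ _ _ _ [x _]; rewrite wF; move: (fracval x) => z ze.
have z0 : 0 < z by rewrite -(pmulr_lgt0 _ e0) ze.
have e1 : e <= z * e by rewrite ler_peMl ?(ltW e0) //; move: z0; lia.
by move: e0 e1; rewrite ze; lia.
Qed.

End FractionValuation.

Definition val0 : F -> int := fracval (fun p => (mup 0 p)%:Z).
Definition valoo : F -> int := fracval (fun p => 1 - (size p)%:Z).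

Let mupD p q : p != 0 -> q != 0 -> p + q != 0 ->
  Num.min (mup 0 p)%:Z (mup 0 q)%:Z <= (mup 0 (p + q))%:Z.
Proof.
move=> p0 q0 pq0; suff : (minn (mup 0 p) (mup 0 q) <= mup 0 (p + q))%N.
  by rewrite ge_min geq_min.
by rewrite mup_geq // dvdp_add // -mup_geq // (geq_minl, geq_minr).
Qed.

Let mupMZ p q : p != 0 -> q != 0 -> (mup 0 (p * q))%:Z = (mup 0 p)%:Z + (mup 0 q)%:Z.
Proof. by move=> p0 q0; rewrite mupM // PoszD. Qed.

Let mupX : mup 0 ('X : {poly k}) = 1%N.
Proof. by have := mup_XsubCX 1 (0 : k) 0; rewrite eqxx expr1 polyC0 subr0. Qed.

Lemma val0_place : place constF val0.
Proof.
apply: fracval_place => //.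
- by move=> c c0; rewrite mupNroot // rootC.
- exists 'X, 1; rewrite polyX_eq0 oner_eq0; split=> //.
  by rewrite mupX mupNroot // rootC oner_eq0.
Qed.

Let sizeM p q : p != 0 -> q != 0 ->
  1 - (size (p * q))%:Z = 1 - (size p)%:Z + (1 - (size q)%:Z).
Proof.
move=> p0 q0; rewrite size_mul //; move: p0 q0; rewrite -!size_poly_gt0.
by move: (size p) (size q) => a b; lia.
Qed.

Lemma valoo_place : place constF valoo.
Proof.
apply: fracval_place => //.
- move=> p q _ _ _; rewrite ge_min; have := size_polyD p q.
  by rewrite leq_max => /orP[] h; apply/orP; [left|right]; lia.
- by move=> c c0; rewrite size_polyC c0.
- exists 1, 'X; rewrite polyX_eq0 oner_eq0; split=> //.
  by rewrite size_poly1 size_polyX.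
Qed.

Let paramE : paramF = tofrac 'X / tofrac 1.
Proof. by rewrite tofrac1 divr1. Qed.

Lemma paramF_neq0 : paramF != 0.
Proof. by rewrite tofrac_eq0 polyX_eq0. Qed.

Lemma val0_param : val0 paramF = 1.
Proof.
rewrite paramE /val0 fracvalE ?polyX_eq0 ?oner_eq0 //.
by rewrite mupX mupNroot // rootC oner_eq0.
Qed.

Lemma valoo_param : valoo paramF = -1.
Proof.
rewrite paramE /valoo fracvalE ?polyX_eq0 ?oner_eq0 //.
by rewrite size_poly1 size_polyX.
Qed.

Let tofrac_MXaddC p c : tofrac (p * 'X + c%:P) = tofrac p * paramF + constF c :> F.
Proof. by rewrite tofracD tofracM. Qed.

Let w_mulX w p : place constF w -> p != 0 ->
  w (tofrac p * paramF) = w (tofrac p) + w paramF.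
Proof.
move=> wP p0; have pF : tofrac p != 0 :> F by rewrite tofrac_eq0.
exact: (place_mul wP pF paramF_neq0).
Qed.

(** Of the two summands of [p * t + c], the constant dominates at a zero of [t]
    and the other one dominates at a pole, so [w] is determined by [w t]. *)
Lemma place_param_gt0 w : place constF w -> 0 < w paramF -> val0 =1 w.
Proof.
move=> wP t0; apply: (place_fracval mupMZ wP t0).
elim/poly_ind => [|p c IH]; first by rewrite eqxx.
rewrite tofrac_MXaddC; have [->|c0] := eqVneq c 0.
  rewrite polyC0 (rmorph0 constF) !addr0 => pX.
  have p0 : p != 0 by apply: contraNneq pX => ->; rewrite mul0r.
  rewrite w_mulX // IH // mupMZ ?polyX_eq0 // mupX; lia.
move=> _; have cF : constF c != 0 by rewrite fmorph_eq0.
rewrite mupNroot ?mul0r; last by rewrite /root hornerMXaddC mulr0 add0r.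
have [->|p0] := eqVneq p 0; first by rewrite tofrac0 mul0r add0r (place_const wP).
have pF : tofrac p != 0 :> F by rewrite tofrac_eq0.
have tF := mulf_neq0 pF paramF_neq0.
rewrite addrC (place_dominant wP cF tF) (place_const wP c0) //.
by rewrite (w_mulX wP p0) (IH p0); move: (mup 0 p) (w paramF) t0 => z e; nia.
Qed.

Lemma place_param_lt0 w : place constF w -> w paramF < 0 -> valoo =1 w.
Proof.
move=> wP t0; have t0' : 0 < - w paramF by rewrite oppr_gt0.
apply: (place_fracval sizeM wP t0').
elim/poly_ind => [|p c IH]; first by rewrite eqxx.
rewrite tofrac_MXaddC size_MXaddC; have [->|p0] := eqVneq p 0.
  rewrite tofrac0 !mul0r !add0r polyC_eq0 => c0.
  by rewrite (place_const wP c0) (negPf c0) size_poly0 subrr mul0r.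
move=> _; have E : w (tofrac p * paramF) = (1 - (size p).+1%:Z) * - w paramF.
  by rewrite (w_mulX wP p0) (IH p0); move: (size p) (w paramF) => z e; lia.
have [->|c0] := eqVneq c 0; first by rewrite (rmorph0 constF) addr0.
have cF : constF c != 0 by rewrite fmorph_eq0.
have pF : tofrac p != 0 :> F by rewrite tofrac_eq0.
have tF := mulf_neq0 pF paramF_neq0.
suff lt : w (tofrac p * paramF) < w (constF c).
  by rewrite (place_dominant wP tF cF lt) E.
rewrite E (place_const wP c0); move: p0; rewrite -size_poly_gt0.
by move: (size p) (w paramF) t0 => z e; nia.
Qed.

End Places.
(** * Curves in orbit closures *)

Section WallCurves.
Variables (R : realType) (k : closedFieldType) (n : nat) (X : fan R n).
Local Notation s := (fan_size X).
Local Notation cone := (@fan_cone R n X).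
Local Notation gens := (@fan_gens R n X).
Implicit Types (i j l : 'I_s) (m : 'I_s -> 'rV[int]_n) (L : local_equations k X).

(** The real functional that cuts out the face [cone i] meets [cone j] in need
    not be rational, but it shows that the negative of a generator outside the
    face is not in the cone spanned by [cone i] and the negatives of the face.
    The theorem of the alternative over the integers then gives a lattice point. *)
Lemma lattice_face i j : (exists2 x, cone i x & ~ cone j x) ->
  exists a, [/\ dual_cone (cone i) a, perp (cap (cone i) (cone j)) a &
    ~ perp (cone i) a].
Proof.
move=> [x xi nxj]; have [e e0 ecap] := fan_caps i j.
have [g0 g0G eg0] : exists2 g, g \in gens i & dotp e (ofZ R g) != 0.
  apply: contrapT => h; apply: nxj; have [] // : cap (cone i) (cone j) x.
  apply/ecap; split=> //; apply: hull_perp xi => g gG.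
  by apply/eqP; apply: contrapT => /negP eg; apply: h; exists g.
have eg0' : 0 < dotp e (ofZ R g0) by rewrite lt0r eg0 e0 //; exact: hull_gen.
pose C (y : 'rV[int]_n) := 0 <= dotp e (ofZ R y).
have [||||[a [aG ag0]]|[z z0]] := @farkas int n C _ _ _
  (gens i ++ [seq - g | g <- gens i & dotp e (ofZ R g) == 0]) (- g0).
- by rewrite /C ofZ0 dotp0r.
- by move=> y z; rewrite /C ofZD dotpDr; exact: addr_ge0.
- by move=> z y z0; rewrite /C ofZZ dotpZr; apply: mulr_ge0; rewrite ler0z.
- move=> g; rewrite mem_cat => /orP[gG|/mapP[h]]; first by apply: e0; exact: hull_gen.
  by rewrite mem_filter => /andP[/eqP eh _] ->; rewrite /C ofZN dotpNr eh oppr0.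
- exists a; split.
  + apply: hull_dual => g gG; rewrite dotp_ofZ ler0z.
    by apply: aG; rewrite mem_cat gG.
  + move=> y yc; have [_] := (ecap y).1 yc;
    apply: (hull_face_perp e0 _ yc.1) => g gG eg.
    rewrite dotp_ofZ; apply/eqP; rewrite intr_eq0 eq_le aG ?mem_cat ?gG // andbT.
    rewrite -oppr_ge0 -dotpNr aG // mem_cat (map_f (fun g => - g)) ?orbT //.
    by rewrite mem_filter gG andbT; apply/eqP.
  + move=> /(_ _ (hull_gen R g0G)); rewrite dotp_ofZ => /eqP; rewrite intr_eq0 => /eqP.
    by move: ag0; rewrite dotpNr => h1 h2; rewrite h2 oppr0 ltxx in h1.
- by rewrite /C ofZZ ofZN dotpZr dotpNr mulrN oppr_ge0 pmulr_rle0 ?ltr0z // leNgt eg0'.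
Qed.

Section Curve.
Variables (F : fieldType) (iota : {rmorphism k -> F}) (t : F) (v0 voo : F -> int).
Hypothesis (hF : curve_function_field iota) (t0 : t != 0).
Hypothesis (v0P : place iota v0) (vooP : place iota voo).
Hypothesis (v0t : v0 t = 1) (voot : voo t = -1).
Hypothesis zero_unique : forall w, place iota w -> 0 < w t -> v0 =1 w.
Hypothesis pole_unique : forall w, place iota w -> w t < 0 -> voo =1 w.

Let orbit_chart (w : F -> int) i p (u : 'rV[int]_n) : place iota w ->
  (forall a, dual_cone (cone p) a -> perp (cone i) a -> 0 <= dotp a u * w t) ->
  forall f, chart p f -> 0 <= w (evalK iota (orbit_char (cone i) u t) f).
Proof.
move=> wP wu f [r dr ->]; rewrite -/(lsum r) evalK_lsum big_seq.
apply: (big_ind (fun x => 0 <= w x)); first by rewrite (place0 wP).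
  by move=> x y; exact: (place_add_ge0 wP).
move=> c cr; have [->|c0] := eqVneq c.1 0; first by rewrite rmorph0 mul0r (place0 wP).
have [pc|npc] := pselect (perp (cone i) c.2); last first.
  by rewrite (orbit_char_nperp _ _ npc) mulr0 (place0 wP).
have cF : iota c.1 != 0 by rewrite fmorph_eq0.
rewrite (orbit_char_perp _ _ pc) (place_mul wP cF (expfz_neq0 _ t0)).
rewrite (place_const wP c0) add0r (place_exprz wP _ t0); apply: wu => //.
exact: dr.
Qed.

(** The closure of the orbit of the one-parameter subgroup [u] through the
    distinguished point of the orbit of [cone i] is a curve with limits in the
    charts of [cone p] and [cone q], and the difference of the local equations
    there is its degree.  No other place contributes: a limit outside the orbit
    of [cone i] would give a character that is zero on the curve but invertible
    at the limit. *)
Lemma nef_orbit_curve L g c m i p q (u : 'rV[int]_n) :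
  nef L -> toric_form L g c m -> compatible m ->
  (forall x, cone i x -> cone p x) -> (forall x, cone i x -> cone q x) ->
  (forall a, dual_cone (cone p) a -> perp (cone i) a -> 0 <= dotp a u) ->
  (forall a, dual_cone (cone q) a -> perp (cone i) a -> dotp a u <= 0) ->
  0 <= dotp (m q - m p) u.
Proof.
move=> Lnef [g0 c0 LE] mC ip iq up uq.
pose x := evalK iota (orbit_char (cone i) u t).
have xP : is_point (chart i) iota x by exact: orbit_point.
have ratio j : L j / L i = constK n (c j / c i) * chi k (m i - m j).
  rewrite !LE chiD constKM constKV !chiN.
  apply: transition g0 _ (chi_neq0 k _) (chi_neq0 k _).
  by rewrite constK_eq0 c0.
have diff_perp j : perp (cap (cone i) (cone j)) (m i - m j).
  by move=> y [yi yj]; rewrite ofZB dotpBl (mC i j y yi yj) subrr.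
have c10 j : iota (c j / c i) != 0.
  by rewrite fmorph_eq0 mulf_neq0 ?invr_eq0 ?c0.
have order w a j : place iota w -> w (iota (c j / c i) * t ^ a) = a * w t.
  move=> wP; rewrite (place_mul wP (c10 j) (expfz_neq0 _ t0)).
  by rewrite (place_const wP) ?(place_exprz wP _ t0) ?add0r // -(fmorph_eq0 iota).
have pull w j : place iota w -> (forall y, cone i y -> cone j y) ->
    (forall a, dual_cone (cone j) a -> perp (cone i) a -> 0 <= dotp a u * w t) ->
    pullback_order L iota i x w (dotp (m i - m j) u * w t).
  move=> wP ij wu; exists j, x; split=> //.
  - have [xc xM] := xP; split=> // f f' fo f'o; apply: xM.
      by case: fo => r dr ->; exists r => // b br y yi; apply: dr => //; split; auto.
    by case: f'o => r dr ->; exists r => // b br y yi; apply: dr => //; split; auto.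
  - exact: orbit_chart.
  - rewrite ratio /x evalK_monomial orbit_char_perp ?order //.
    by move=> y yi; apply: diff_perp; split; auto.
have only w e : place iota w -> pullback_order L iota i x w e -> e != 0 -> w t != 0.
  move=> wP [j [y [yP yx yj ->]]]; rewrite ratio (point_monomial _ yP); last first.
    exact/perp_dual/diff_perp.
  have ij : forall z, cone i z -> cone j z.
    move=> z zi; apply: contrapT => nzj.
    have [|a [da pa npa]] := @lattice_face i j; first by exists z.
    have := point_chi_neq0 yP pa; rewrite yx; last exact: reg_chi.
    by rewrite /x evalK_chi orbit_char_nperp // eqxx.
  have pij : perp (cone i) (m i - m j).
    by move=> z zi; apply: diff_perp; split; auto.
  rewrite yx; last exact/reg_chi/perp_dual.
  rewrite /x evalK_chi orbit_char_perp // order //.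
  by apply: contraNneq => ->; rewrite mulr0.
apply: (Lnef F iota hF i x xP).
exists 2, (fun a => if a == 0 then v0 else voo),
  (fun a => if a == 0 then dotp (m i - m p) u else - dotp (m i - m q) u).
split.
- move=> a; case: ifP => _; split=> //.
    by rewrite -[dotp _ _]mulr1 -v0t; apply: pull => // b db pb; rewrite v0t mulr1 up.
  rewrite -[dotp _ _]mulr1 -mulrN -voot; apply: pull => // b db pb.
  by rewrite voot mulrN1 oppr_ge0 uq.
- move=> a b; case: ifP => [/eqP->|a0]; case: ifP => [/eqP->|b0] // e.
  + by move: (e t); rewrite v0t voot.
  + by move: (e t); rewrite v0t voot.
  + by apply: val_inj; case: a a0 {e} => -[|[|]] //; case: b b0 => -[|[|]].
- move=> w e wP we /(only w e wP we); rewrite neq_lt => /orP[wt|wt].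
    by exists 1; exact: pole_unique.
  by exists 0; exact: zero_unique.
- by rewrite !big_ord_recl big_ord0 /= !dotpBl; ring.
Qed.
End Curve.
End WallCurves.
(** * Nef and ample line bundles *)

Section Positivity.
Variables (R : realType) (k : closedFieldType) (n : nat) (X : fan R n).
Local Notation s := (fan_size X).
Local Notation cone := (@fan_cone R n X).
Local Notation gens := (@fan_gens R n X).
Implicit Types (i j l : 'I_s) (m q : 'I_s -> 'rV[int]_n) (L : local_equations k X).
Hypothesis hX : complete_fan X.

Lemma fan_cap i l : exists t, forall x, cone t x <-> cap (cone i) (cone l) x.
Proof. exact: fan_faces (fan_caps i l). Qed.

(** Where a segment passes from one maximal cone to another, the one-parameter
    subgroup in its direction has an orbit in the orbit of their intersection,
    with one limit in the chart of each cone. *)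
Lemma nef_is_nef_tuple L g c m : nef L -> toric_form L g c m -> compatible m ->
  nef_tuple m.
Proof.
move=> Lnef LE mC; apply: (local_global hX) => [i l x _ _|]; first exact: mC.
move=> i l w u b e e' fi fl _ wi wl e0 e'0 iu lu.
have [t tcap] := fan_cap i l; have wt : cone t w by apply/tcap.
suff : 0 <= dotp (m i - m l) u.
  rewrite -(ler0z R) -dotp_ofZ -[m i - m l]opprB ofZN dotpNl oppr_ge0; exact.
apply: (nef_orbit_curve (curve_function_field_ratfun k) (paramF_neq0 k) (val0_place k)
  (valoo_place k) (val0_param k) (valoo_param k) (@place_param_gt0 k)
  (@place_param_lt0 k) Lnef LE mC (i := t)).
- by move=> x /tcap[].
- by move=> x /tcap[].
- move=> a /(_ _ lu) + pa; rewrite dotpDr pa // add0r dotpZr pmulr_rge0 //.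
  by rewrite dotp_ofZ ler0z.
- move=> a /(_ _ iu) + pa; rewrite dotpBr pa // sub0r dotpZr oppr_ge0 pmulr_rle0 //.
  by rewrite dotp_ofZ lerz0.
Qed.

Section VeryAmple.
Variables (L : local_equations k X) (d : nat) (g : funK k n) (c : 'I_s -> k).
Variables (m : 'I_s -> 'rV[int]_n).
Hypotheses (d0 : (0 < d)%N) (VA : very_ample (tensor_pow L d)).
Hypotheses (LE : toric_form L g c m) (mC : compatible m).

Lemma section_value f : 'I_s -> H0 (tensor_pow L d) f -> exists r,
  (forall t, t \in r -> forall i, dual_cone (cone i) (t.2 - m i *+ d)) /\
  forall i (phi : 'rV[int]_n -> k),
    evalK idfun phi (f * tensor_pow L d i) =
    \sum_(t <- r) t.1 * c i ^+ d * phi (t.2 - m i *+ d).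
Proof.
move=> i0 Hf; have LdE := toric_form_pow d LE.
have [r [_ fg dr]] := H0_toric i0 LdE Hf; exists r; split=> // i phi.
have [_ _ ->] := LdE; rewrite mulrA fg -lsum_shift evalK_lsum big_map.
by apply: eq_bigr => t _.
Qed.

(** A section that does not vanish at the fixed point of a maximal cone has the
    corresponding vertex among its exponents. *)
Lemma very_ample_nef_tuple : nef_tuple m.
Proof.
have [r [sec [H0s gen _ _]]] := VA.
suff vertex i j : fullc i -> dual_cone (cone j) (m i *+ d - m j *+ d).
  move=> i j fi fj v vG; have := vertex j i fj _ (hull_gen R vG).
  by rewrite ofZB !ofZMn -scalerBr -ofZB dotpZl pmulr_rge0 ?ltr0n // dotp_ofZ ler0z.
move=> fi; pose phi := orbit_char (cone i) 0 (1 : k).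
have xP : is_kpoint i (evalK idfun phi) by apply: orbit_point; exact: oner_neq0.
have [l] := gen i _ xP; have [q [dq ->]] := section_value i (H0s l).
move=> sum0; have [t tq phit] : exists2 t, t \in q & phi (t.2 - m i *+ d) != 0.
  apply: contrapT => h; case/eqP: sum0; rewrite big_seq big1 // => t tq.
  have [->|pt] := eqVneq (phi (t.2 - m i *+ d)) 0; first by rewrite mulr0.
  by case: h; exists t.
have pt : perp (cone i) (t.2 - m i *+ d).
  by apply: contrapT => npt; case/eqP: phit; exact: orbit_char_nperp.
have <- : t.2 = m i *+ d.
  by apply/eqP; rewrite -subr_eq0; apply/eqP/(@ofZ_inj R); rewrite ofZ0; exact: fi.
exact: dq.
Qed.

(** If the two vertices coincided, every section would restrict to the orbit of
    the wall as a multiple of one and the same character, so all points of this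
    orbit would have the same image.  The nonzero character [q l - q i] separates
    points of the orbit, and it forces the exponents of the sections that do not
    vanish on the orbit to be the common vertex. *)
Lemma very_ample_strict q i l (b : 'rV[int]_n) : nef_tuple q ->
  fullc i -> fullc l -> wall i l b -> q i != q l -> m i != m l.
Proof.
move=> qN fi fl W qil; apply/eqP => mil.
pose Q := q l - q i.
have Q0 : ofZ R Q != 0 by exact: ofZ_sub_neq0.
have Qperp := nef_tuple_perp qN fi fl.
have Qb : dotp Q b != 0.
  apply: contraNneq Q0 => Qb; rewrite (W (ofZ R Q)) // dotp_ofZ Qb //.
have [t tcap] := fan_cap i l.
have [z [z0 zQ]] : exists z : k, z != 0 /\ z ^ dotp Q b != 1.
  (* A root of [z (z ^ N - 1) + 1] is neither 0 nor an [N]-th root of unity. *)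
  pose N := `|dotp Q b|%N; have N0 : (0 < N)%N by rewrite absz_gt0.
  have /closed_rootP[z] : size ('X * ('X^N - 1) + 1 : {poly k}) != 1%N.
    rewrite mulrC -[X in _ + X]/(1%:P) size_MXaddC.
    rewrite oner_eq0 andbF eqSS size_poly_eq0 -size_poly_eq0 size_XnsubC //.
  rewrite /root !hornerE => /eqP rz; exists z.
  have z0 : z != 0 by apply: contra_eq_neq rz => ->; rewrite mul0r add0r oner_neq0.
  have zN : z ^+ N != 1.
    by apply: contra_eq_neq rz => ->; rewrite subrr mulr0 add0r oner_neq0.
  split=> //; move: zN; rewrite /N; case: (dotp Q b) => a //=.
  by rewrite NegzE -exprz_inv -exprnP exprVn invr_eq1.
(* Two points of the orbit of the wall: [x 1] and [x z]. *)
pose x (e : k) := evalK idfun (orbit_char (cone t) b e).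
have xP e : e != 0 -> is_kpoint t (x e) by exact: orbit_point.
have [r [sec [H0s _ inj _]]] := VA.
have [|y [_ y1 yz]] := inj t (x 1) t (x z) (xP _ (oner_neq0 _)) (xP _ z0).
  exists (z ^ dotp (m i *+ d - m t *+ d) b) => [|a]; first exact: expfz_neq0.
  have [w [dw wE]] := section_value i (H0s a); rewrite /x !wE mulr_sumr.
  rewrite big_seq [RHS]big_seq; apply: eq_bigr => v vw.
  have [pv|npv] := pselect (perp (cone t) (v.2 - m t *+ d)); last first.
    by rewrite !(orbit_char_nperp _ _ npv) !mulr0.
  rewrite !(orbit_char_perp _ _ pv) exp1rz mulr1 mulrC; congr (_ ^ dotp _ b * _).
  congr (_ - _); apply/eqP; rewrite -subr_eq0; apply/eqP/(@ofZ_inj R); rewrite ofZ0.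
  have vperp y : cone i y -> cone l y -> dotp (ofZ R (v.2 - m i *+ d)) y = 0.
    move=> yi yl; have yt : cone t y by apply/tcap.
    have := pv y yt; rewrite !ofZB !ofZMn !dotpBl !dotpZl (mC yi yt) => ->.
    by [].
  have vE := wall_collinear W Qperp vperp Q0.
  have [h hG Qh] := full_gen fi Q0; have [h' h'G Qh'] := full_gen fl Q0.
  have Qh0 : 0 < dotp (ofZ R Q) (ofZ R h).
    rewrite lt0r Qh (nef_tuple_ge0 qN) //; exact: hull_gen.
  have Qh'0 : dotp (ofZ R Q) (ofZ R h') < 0.
    rewrite lt_neqAle Qh' -oppr_ge0 -dotpNl -ofZN opprB (nef_tuple_ge0 qN) //.
    exact: hull_gen.
  have := dw _ vw i _ (hull_gen R hG); have := dw _ vw l _ (hull_gen R h'G).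
  rewrite -mil vE !dotpZl (pmulr_lge0 _ Qh0) (nmulr_lge0 _ Qh'0) => la0 la1.
  by rewrite (le_anti (introT andP (conj la0 la1))) scale0r.
have pQ : perp (cone t) Q by move=> v /tcap[vi vl]; exact: Qperp.
have cQ : chart t (chi k Q) by apply: reg_chi; exact: perp_dual.
have := y1 _ cQ; rewrite (yz _ cQ) /x !evalK_chi !(orbit_char_perp _ _ pQ) exp1rz.
by move/eqP; rewrite (negPf zQ).
Qed.

End VeryAmple.
End Positivity.
(** * Surjectivity of the multiplication map *)

Lemma surjective_of_decomposition (R : realType) (k : closedFieldType) (n : nat)
    (X : fan R n) (L1 L2 : local_equations k X) g1 g2 c1 c2 m1 m2 :
  complete_fan X -> toric_form L1 g1 c1 m1 -> toric_form L2 g2 c2 m2 ->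
  compatible m1 -> compatible m2 ->
  (forall x, in_polytope (X := X) (fun i => m1 i + m2 i) x ->
    exists a b, [/\ x = a + b, in_polytope (X := X) m1 a &
      in_polytope (X := X) m2 b]) ->
  mult_surjective L1 L2.
Proof.
move=> hX L1E L2E m1C m2C dec f Hf; have [i0 _ _] := full_cover hX 0.
have LE := toric_form_tensor L1E L2E.
have [r [_ fg dr]] := H0_toric i0 LE Hf.
have /choice[ab hab] : forall t : k * 'rV[int]_n, exists ab : 'rV[int]_n * 'rV[int]_n,
    t \in r -> [/\ t.2 = ab.1 + ab.2, in_polytope (X := X) m1 ab.1 &
      in_polytope (X := X) m2 ab.2].
  move=> t; have [tr|_] := boolP (t \in r); last by exists (0, 0).
  by have [a [b h]] := dec _ (dual_in_polytope (dr t tr)); exists (a, b).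
exists [seq (constK n t.1 * chi k (ab t).1 / g1,
    constK n 1 * chi k (ab t).2 / g2) | t <- r].
  move=> _ /mapP[t /hab[_ a1 b2] ->]; split.
    exact: (H0_monomial _ L1E (in_polytope_dual hX m1C a1)).
  exact: (H0_monomial _ L2E (in_polytope_dual hX m2C b2)).
have [g10 _ _] := L1E; have [g20 _ _] := L2E.
rewrite big_map -[LHS](mulfK (mulf_neq0 g10 g20)) fg mulr_suml big_seq [RHS]big_seq.
apply: eq_bigr => t /hab[tE _ _] /=.
by rewrite tE chiD constK1 mul1r mulf_div mulrA.
Qed.

Theorem proposition3p1 (R : realType) (k : closedFieldType) (n : nat)
    (X : fan R n) (hX : projective k X) :
  exists N : nat, forall L1 L2 : local_equations k X,
    line_bundle L1 -> line_bundle L2 ->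
    ample L1 -> min_edge_length_ge L1 N -> nef L2 ->
    mult_surjective L1 L2.
Proof.
have [cX _] := hX; have [i0 _ _] := full_cover cX 0.
have [Q Qgen] := nef_generators X; have [Qnef _] := Qgen.
pose C := (\max_(f <- Q) \max_(i < fan_size X) \max_(l < fan_size X) \max_(z < n)
  `|f l 0%R z - f i 0%R z|)%N.
have QC f : f \in Q -> forall i l z, (`|f l 0%R z - f i 0%R z| <= C)%N.
  move=> fQ i l z; rewrite /C (big_rem f fQ) /=; apply: leq_trans (leq_maxl _ _).
  apply: leq_trans (leq_bigmax i); apply: leq_trans (leq_bigmax l).
  exact: (leq_bigmax (F := fun z => `|f l 0%R z - f i 0%R z|%N) z).
exists (fan_size X * C)%N => L1 L2 lb1 lb2 [d d0 VA] edges L2nef.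
have [g1 [c1 [m1 [L1E m1C]]]] := line_bundle_toric i0 lb1.
have [g2 [c2 [m2 [L2E m2C]]]] := line_bundle_toric i0 lb2.
have m1N := very_ample_nef_tuple d0 VA L1E.
have m2N := nef_is_nef_tuple cX L2nef L2E m2C.
apply: (surjective_of_decomposition cX L1E L2E m1C m2C) => x.
apply: (minkowski_decomposition cX Qgen m1N _ m2N) => f fQ.
apply: (long_edges_nef cX m1N m1C (Qnef f fQ) (QC f fQ) (leqnn _)).
  exact: edges (toric_form_isom L1E).
move=> i l b fi fl W; exact: (very_ample_strict VA L1E m1C (Qnef f fQ) fi fl W).
Qed.
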